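(* Let $\mathbb{K}$ be the field of generalized Puiseux series and let $H$ be the entropy map on lattices in $\mathbb{K}^3$, with image $\mathrm{im}(H)\subset\mathcal{S}_3\subset\mathbb{R}^7$. Let $\mathcal{P}$ and $\mathcal{C}$ be the projections of $\mathrm{im}(H)$ and of $\mathcal{S}_3$, respectively, onto $W$ parallel to the lineality space $\mathcal{L}_3$ of $\mathcal{S}_3$, with coordinates $(w,x,y,z)=(x_2,x_3,x_{13},x_{23})$ on $W$. Then $\mathrm{im}(H)=\mathcal{P}+\mathcal{L}_3$, and $\mathcal{P}$ is the union of the following three sets: $$\{w\le0,\ x\le w+y,\ y\le0,\ z=x\},$$ $$\{w\le0,\ x\le y,\ y\le0,\ y+w\le x,\ z=y+w\},$$ $$\{w\le0,\ y\le0,\ x=y+w,\ z\le w,\ x\le z\}.$$ In particular $\mathcal{P}$ is a polyhedral fan of dimension $3$, namely a union of three pointed polyhedral cones of dimension $3$, contained in the cone $\mathcal{C}$, which is a pointed cone of dimension $4$.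
   Context: $\mathbb{K}$ is the field of generalized Puiseux series: formal series $f=\sum_{\alpha\in\mathbb{R}}a_\alpha t^\alpha$ (real coefficients) whose support $\{\alpha\in\mathbb{R}:a_\alpha\ne0\}$ is either finite or has $+\infty$ as its only accumulation point; $\mathrm{val}(f)$ is the minimum of the support for $f\neq 0$, and $\mathrm{val}(0)=+\infty$, so the valuation group is $\mathbb{R}$. Let $\mathcal{O}=\{f:\mathrm{val}(f)\ge0\}$. A lattice in $\mathbb{K}^d$ is $\Lambda=A\mathcal{O}^d$ with $A\in\mathrm{GL}_d(\mathbb{K})$ (a representative of $\Lambda$). Write $[d]=\{1,\dots,d\}$. For $I\subset[d]$, $h_I(\Lambda)=\min_{J\subset[d],|J|=|I|}\mathrm{val}(\det(A_{I\times J}))$, where $A_{I\times J}$ has rows $I$ and columns $J$; this does not depend on $A$; $h_\emptyset(\Lambda)=0$. The entropy map is $H(\Lambda)=(h_I(\Lambda))_{I\subset[d]}$. The supermodular cone is $\mathcal{S}_d=\{x=(x_I)_{I\subset[d]}\in\mathbb{R}^{2^d}: x_\emptyset=0,\ x_I+x_J\le x_{I\cap J}+x_{I\cup J}\ \forall I,J\subset[d]\}$, viewed in $\mathbb{R}^{2^d-1}$ by dropping $x_\emptyset$. Its lineality space is the largest linear subspace contained in it. For $d=3$, write vectors of $\mathbb{R}^7$ as $(x_1,x_2,x_3;x_{12},x_{13},x_{23};x_{123})$. The lineality space $\mathcal{L}_3$ of $\mathcal{S}_3$ has dimension $3$, and it has as a complement the linear space $W\subset\mathbb{R}^7$ of vectors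 with $x_1=x_{12}=x_{123}=0$, whose elements are written $(w,x,y,z)=(x_2,x_3,x_{13},x_{23})$. *)

(* Defs.v *)
From HB Require Import structures.
From mathcomp Require Import all_boot all_order all_algebra.
From mathcomp Require Import perm mathcomp_extra boolp classical_sets functions.
From mathcomp Require Import cardinality fsbigop reals ereal topology.
From mathcomp Require Import normedtype sequences.
From mathcomp Require Import lra.

Set Implicit Arguments.
Unset Strict Implicit.
Unset Printing Implicit Defensive.

Import Order.TTheory GRing.Theory Num.Theory.
Import numFieldNormedType.Exports.

Local Open Scope classical_set_scope.
Local Open Scope ring_scope.

Section LeftFinite.
Variable R : realType.
Implicit Types (f g h : R -> R) (S : set R).

Definition puiseux_support f : set R := [set a | f a != 0].

(* Accumulation points are taken in the extended real line; [left_finiteP] below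
   restates the condition: finitely many exponents below every real bound. *)
Definition puiseux_pred f : Prop :=
  finite_set (puiseux_support f) \/
  limit_point (EFin @` puiseux_support f) = [set +oo%E].

Definition left_finite S := forall r, finite_set (S `&` [set a | a <= r]).

Lemma seq_min (s : seq R) : s != [::] ->
  exists2 m, m \in s & forall a, a \in s -> m <= a.
Proof.
elim: s => [//|x [|y s] IH] _; first by exists x; rewrite ?mem_head // => a; rewrite inE => /eqP ->.
have [|m ms mle] := IH; first by []; have [xm|mx] := leP x m.
  exists x; first exact: mem_head.
  by move=> a; rewrite inE => /predU1P[->//|/mle]; apply: le_trans.
exists m; first by rewrite inE ms orbT.
by move=> a; rewrite inE => /predU1P[->//|/mle//]; exact: ltW.
Qed.

Lemma left_finite_min S : left_finite S -> S !=set0 ->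
  exists2 m, S m & forall a, S a -> m <= a.
Proof.
move=> fS [a0 Sa0]; have /finite_seqP[s sE] := fS a0.
have a0s : a0 \in s by have : [set` s] a0 by rewrite -sE; split => /=.
have [|m ms mle] := @seq_min s; first by apply/eqP => s0; rewrite s0 in a0s.
have [Sm ma0] : (S `&` [set a | a <= a0]) m by rewrite sE.
exists m => // a Sa; have [aa0|/ltW] := leP a a0; last exact: le_trans.
by apply: mle; have : (S `&` [set a | a <= a0]) a by []; rewrite sE.
Qed.

Lemma left_finite_lb S : left_finite S -> exists m, forall a, S a -> m <= a.
Proof.
move=> fS; have [->|/set0P S0] := eqVneq S set0; first by exists 0.
by have [m _ mP] := left_finite_min fS S0; exists m.
Qed.

Lemma left_finiteP S :
  left_finite S <->
    (finite_set S \/ limit_point (EFin @` S) = [set +oo%E]).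
Proof.
split=> [fS|[finS r|limS r]]; last 2 first.
- exact: finite_setIl.
- set T := S `&` _; apply: contrapT => infT.
  have [bT|ubT] := pselect (exists m, forall a, T a -> m <= a).
    case: bT => m mT.
    have [|l Tl] := @infinite_bounded_limit_point_nonempty R T infT.
      exists (`|m| + `|r|); split; first by rewrite num_real.
      move=> M mM a Ta /=; have [_ /= ar] := Ta; have := mT a Ta.
      move=> ma; apply: (le_trans _ (ltW mM)); rewrite ler_norml.
      have := ler_norm m; have := ler_norm (- m).
      have := ler_norm r; have := ler_norm (- r); rewrite !normrN.
      by move=> *; apply/andP; split; lra.
    have : limit_point (EFin @` S) l%:E.
      move=> U /= Ul; have [y [yl [Sy _] Uy]] := Tl _ Ul.
      by exists y%:E; split=> //; exists y.
    by rewrite limS.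
  have : limit_point (EFin @` S) -oo%E.
    move=> U /= [M [Mr MU]]; apply: contrapT => nU; apply: ubT; exists M => a [Sa _].
    rewrite leNgt; apply/negP => aM; apply: nU; exists a%:E; split=> //; first by exists a.
    by apply: MU; rewrite lte_fin.
  by rewrite limS.
have [finS|infS] := pselect (finite_set S); [by left|right].
apply/seteqP; split=> [[r||] lp|_ -> U /= [M [_ MU]]] //=; last first.
- apply: contrapT => nU; apply: infS.
  apply: sub_finite_set (fS M) => a Sa; split=> //=.
  rewrite leNgt; apply/negP => Ma; apply: nU; exists a%:E; split=> //; first by exists a.
  by apply: MU; rewrite lte_fin.
- have [m mS] := left_finite_lb fS.
  have [|y [_ [a Sa <-]]] := lp [set x | (x < m%:E)%E].
    by exists m; split; rewrite ?num_real.
  by rewrite /= lte_fin ltNge mS.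
- have infE : (forall U, nbhs r U -> infinite_set (U `&` S)).
    apply/limit_point_infinite_setP => U Ur.
    have [|y [yr [a Sa ay] [b Ub bE]]] := lp (EFin @` U).
      by rewrite /nbhs /= /ereal_nbhs; apply: filterS Ur => x Ux; exists x.
    move: bE yr; rewrite -ay => -[ba] yr; exists a.
    by split=> //; rewrite -ba.
  exfalso; apply: (infE [set x | x < r + 1]).
    by apply: lt_nbhsl; rewrite ltrDl.
  by apply: sub_finite_set (fS (r + 1)) => a [/= ar Sa]; split=> //=; exact: ltW.
Qed.
End LeftFinite.

Record puiseux (R : realType) := Puiseux {
  pcoef :> R -> R ;
  pcoefP : puiseux_pred pcoef }.

HB.instance Definition _ (R : realType) := gen_eqMixin (puiseux R).
HB.instance Definition _ (R : realType) := gen_choiceMixin (puiseux R).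

Section PuiseuxRing.
Variable R : realType.
Implicit Types f g h : R -> R.
Local Notation K := (puiseux R).
Implicit Types p q u : K.

Definition plf f := left_finite (puiseux_support f).

Lemma plfP f : puiseux_pred f <-> plf f.
Proof. by rewrite /plf left_finiteP. Qed.

Lemma pcoef_lf p : plf p. Proof. exact/plfP/pcoefP. Qed.

Lemma puiseux_eq p q : pcoef p =1 pcoef q -> p = q.
Proof.
case: p q => f fP [g gP] /= /funext fg; rewrite fg in fP *.
by congr Puiseux; exact: Prop_irrelevance.
Qed.

Lemma plf_lb f : plf f -> exists m, forall a, f a != 0 -> m <= a.
Proof. exact: left_finite_lb. Qed.

Lemma plf_seq f r : plf f -> exists2 s : seq R, uniq s &
  forall a, (a \in s) = (f a != 0) && (a <= r).
Proof.
move=> /(_ r)/finite_seqP[s sE]; exists (undup s); first exact: undup_uniq.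
move=> a; rewrite mem_undup; apply/idP/andP => [as_|[fa ar]].
  by have : [set` s] a by []; rewrite -sE => -[].
by have : (puiseux_support f `&` [set a | a <= r]) a by []; rewrite sE.
Qed.

Lemma plf_sub f (S : set R) : left_finite S -> (forall a, f a != 0 -> S a) -> plf f.
Proof. by move=> fS fsub r; apply: sub_finite_set (fS r) => a [/fsub]. Qed.

Lemma plf0 : plf (fun=> 0).
Proof.
move=> r; apply: (@sub_finite_set _ _ set0) => // a [].
by rewrite /puiseux_support /= eqxx.
Qed.

Lemma plfD f g : plf f -> plf g -> plf (fun a => f a + g a).
Proof.
move=> lff lfg r.
apply: (@sub_finite_set _ _ ((puiseux_support f `&` [set a | a <= r]) `|`
                             (puiseux_support g `&` [set a | a <= r]))).
  move=> a [/= fga ar]; have [fa0|] := eqVneq (f a) 0; last by left.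
  by right; split=> //=; move: fga; rewrite /puiseux_support /= fa0 add0r.
by rewrite finite_setU; split; [exact: lff|exact: lfg].
Qed.

Lemma plfN f : plf f -> plf (fun a => - f a).
Proof. by move=> lff; apply: (plf_sub lff) => a; rewrite oppr_eq0. Qed.

Definition pmono (c : R) (a0 : R) := fun a : R => if a == a0 then c else 0.

Lemma pmono_neq0 c a0 a : pmono c a0 a != 0 -> a = a0.
Proof. by rewrite /pmono; have [//|_] := eqVneq a a0; rewrite eqxx. Qed.

Lemma plf_pmono c a0 : plf (pmono c a0).
Proof.
move=> r; apply: (@sub_finite_set _ _ [set a0]); last exact: finite_set1.
by move=> a [/pmono_neq0].
Qed.

(* For left-finite [f] and [g] the sum has finitely many nonzero terms. *)
Definition pconv f g := fun c : R => \sum_(a \in [set: R]) f a * g (c - a).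

Lemma pconvE f g c (s : seq R) : uniq s ->
  (forall a, f a != 0 -> g (c - a) != 0 -> a \in s) ->
  pconv f g c = \sum_(a <- s) f a * g (c - a).
Proof.
move=> us sP; rewrite fsbig_seq //; apply/esym/fsbig_widen => // a [_ /= nas].
apply: contrapT => /eqP; rewrite mulf_eq0 negb_or => /andP[fa ga].
by apply: nas; exact: sP.
Qed.

Lemma pconv_seq f g c : plf f -> plf g -> exists2 s : seq R, uniq s &
  forall d a, d <= c -> f a != 0 -> g (d - a) != 0 -> a \in s.
Proof.
move=> lff /plf_lb[m mg]; have [s us sP] := plf_seq (c - m) lff.
exists s => // d a dc fa ga; rewrite sP fa /=.
by have := mg _ ga; lra.
Qed.

Lemma pconvC f g : plf f -> plf g -> pconv f g = pconv g f.
Proof.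
move=> lff lfg; apply/funext => c; have [s us sP] := pconv_seq c lff lfg.
rewrite (@pconvE f g c s) //; last by move=> a; exact: sP.
rewrite (@pconvE g f c [seq c - a | a <- s]); first last.
- move=> a ga fa; apply/mapP; exists (c - a); last by rewrite subKr.
  by apply: (sP c) => //; rewrite subKr.
- by rewrite map_inj_uniq // => x y /addrI/oppr_inj.
by rewrite big_map; apply: eq_bigr => a _; rewrite subKr mulrC.
Qed.

Lemma pconv_neq0 f g c : pconv f g c != 0 -> exists2 a, f a != 0 & g (c - a) != 0.
Proof.
apply: contraPP => nex; rewrite /pconv fsbig1 ?eqxx // => a _.
apply/eqP; rewrite mulf_eq0; apply/negPn/negP; rewrite negb_or => /andP[fa ga].
by apply: nex; exists a.
Qed.

Lemma plf_conv f g : plf f -> plf g -> plf (pconv f g).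
Proof.
move=> lff lfg r; have [mf mfP] := plf_lb lff; have [mg mgP] := plf_lb lfg.
apply: sub_finite_set (finite_image2 (fun a b => a + b) (lff (r - mg)) (lfg (r - mf))).
move=> c [/pconv_neq0[a fa ga] /= cr]; exists a.
  by split => //=; have := mgP _ ga; lra.
exists (c - a); last lra.
by split => //=; have := mfP _ fa; lra.
Qed.

Lemma pconvDl f g h : plf f -> plf g -> plf h ->
  pconv (fun a => f a + g a) h = (fun a => pconv f h a + pconv g h a).
Proof.
move=> lff lfg lfh; apply/funext => c.
have [s1 us1 s1P] := pconv_seq c lff lfh; have [s2 us2 s2P] := pconv_seq c lfg lfh.
pose s := undup (s1 ++ s2).
have us : uniq s by exact: undup_uniq.
have fs a : f a != 0 -> h (c - a) != 0 -> a \in s.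
  by move=> fa ha; rewrite mem_undup mem_cat (s1P c).
have gs a : g a != 0 -> h (c - a) != 0 -> a \in s.
  by move=> ga ha; rewrite mem_undup mem_cat (s2P c) ?orbT.
rewrite !(@pconvE _ h c s) // -?big_split /=; last first.
  move=> a fga ha; have [fa0|fa] := eqVneq (f a) 0; last exact: fs.
  by apply: gs => //; move: fga; rewrite fa0 add0r.
by apply: eq_bigr => a _; rewrite mulrDl.
Qed.

Lemma pconv1l f : pconv (pmono 1 0) f = f.
Proof.
apply/funext => c; rewrite (@pconvE _ _ c [:: 0]) //.
  by rewrite big_seq1 /pmono eqxx mul1r subr0.
by move=> a /pmono_neq0 ->; rewrite mem_head.
Qed.

Lemma pconvA f g h : plf f -> plf g -> plf h -> pconv f (pconv g h) = pconv (pconv f g) h.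
Proof.
move=> lff lfg lfh; apply/funext => c.
have lfgh := plf_conv lfg lfh; have lffg := plf_conv lff lfg.
have [mf mfP] := plf_lb lff; have [mg mgP] := plf_lb lfg; have [mh mhP] := plf_lb lfh.
have [s us sP] := plf_seq (c - mg - mh) lff.
have [t ut tP] := plf_seq (c - mf - mh) lfg.
pose w := undup [seq a + b | a <- s, b <- t].
have uw : uniq w by exact: undup_uniq.
rewrite (@pconvE f _ c s) //; last first.
  move=> a fa /pconv_neq0[b gb hb]; rewrite sP fa /=.
  by have := mgP _ gb; have := mhP _ hb; lra.
rewrite (@pconvE _ h c w) //; last first.
  move=> e /pconv_neq0[a fa gea] hce; rewrite mem_undup; apply/allpairsP.
  exists (a, e - a); rewrite /= sP tP fa gea /=; split; last lra.
    by have := mgP _ gea; have := mhP _ hce; lra.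
  by have := mfP _ fa; have := mhP _ hce; lra.
transitivity (\sum_(e <- w) \sum_(a <- s) f a * g (e - a) * h (c - e)).
  rewrite exchange_big /=; apply: eq_big_seq => a; rewrite sP => /andP[fa ac].
  rewrite (@pconvE g h _ [seq e - a | e <- w]).
  - rewrite big_map big_distrr /=; apply: eq_bigr => e _.
    by rewrite mulrA; congr (_ * h _); lra.
  - by rewrite map_inj_uniq // => x y /addIr.
  - move=> b gb hb; apply/mapP; exists (a + b); last lra.
    rewrite mem_undup; apply/allpairsP; exists (a, b); split=> //=.
      by rewrite sP fa.
    by rewrite tP gb /=; have := mfP _ fa; have := mhP _ hb; lra.
apply: eq_big_seq => e; rewrite mem_undup => /allpairsP[[a0 b0] /= [a0s b0t ->]].
have [he|he] := eqVneq (h (c - (a0 + b0))) 0.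
  by rewrite he mulr0 big1 // => a _; rewrite mulr0.
rewrite -big_distrl /=; congr (_ * _); apply/esym/pconvE => // a fa gea.
by rewrite sP fa /=; have := mgP _ gea; have := mhP _ he; lra.
Qed.

Definition pzero : K := Puiseux ((plfP _).2 plf0).
Definition pone : K := Puiseux ((plfP _).2 (plf_pmono 1 0)).
Definition padd p q : K :=
  Puiseux ((plfP _).2 (plfD (@pcoef_lf p) (@pcoef_lf q))).
Definition popp p : K := Puiseux ((plfP _).2 (plfN (@pcoef_lf p))).
Definition pmul p q : K :=
  Puiseux ((plfP _).2 (plf_conv (@pcoef_lf p) (@pcoef_lf q))).

Lemma paddA : associative padd.
Proof. by move=> p q r; apply: puiseux_eq => a /=; rewrite addrA. Qed.
Lemma paddC : commutative padd.
Proof. by move=> p q; apply: puiseux_eq => a /=; rewrite addrC. Qed.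
Lemma padd0 : left_id pzero padd.
Proof. by move=> p; apply: puiseux_eq => a /=; rewrite add0r. Qed.
Lemma paddN : left_inverse pzero popp padd.
Proof. by move=> p; apply: puiseux_eq => a /=; rewrite addNr. Qed.

HB.instance Definition _ := GRing.isZmodule.Build K paddA paddC padd0 paddN.

Lemma pmulA : associative pmul.
Proof.
move=> p q r; apply: puiseux_eq => a /=.
by rewrite pconvA //; exact: pcoef_lf.
Qed.
Lemma pmulC : commutative pmul.
Proof.
by move=> p q; apply: puiseux_eq => a /=; rewrite pconvC //; exact: pcoef_lf.
Qed.
Lemma pmul1 : left_id pone pmul.
Proof. by move=> p; apply: puiseux_eq => a /=; rewrite pconv1l. Qed.
Lemma pmulDl : left_distributive pmul padd.
Proof.
move=> p q r; apply: puiseux_eq => a /=.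
by rewrite pconvDl //; exact: pcoef_lf.
Qed.
Lemma pone_neq0 : pone != 0.
Proof.
apply/eqP => /(congr1 (fun p : K => pcoef p 0)) /=.
by rewrite /pmono eqxx; apply/eqP/oner_neq0.
Qed.

HB.instance Definition _ :=
  GRing.Zmodule_isComNzRing.Build K pmulA pmulC pmul1 pmulDl pone_neq0.

Lemma pcoef0 a : (0 : K) a = 0. Proof. by []. Qed.
Lemma pcoef1 a : (1 : K) a = (a == 0)%:R.
Proof. by rewrite /= /pmono; case: eqP. Qed.
Lemma pcoefD p q a : (p + q) a = p a + q a. Proof. by []. Qed.
Lemma pcoefN p a : (- p) a = - p a. Proof. by []. Qed.
Lemma pcoefM p q a : (p * q) a = pconv p q a. Proof. by []. Qed.
Lemma pcoef_sum I (s : seq I) (F : I -> K) a :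
  (\sum_(i <- s) F i) a = \sum_(i <- s) F i a.
Proof. by elim/big_rec2: _ => // i x y _ <-. Qed.


Lemma pcoefX_gt u v n a : (forall b, u b != 0 -> v <= b) ->
  (u ^+ n) a != 0 -> n%:R * v <= a.
Proof.
move=> uv; elim: n a => [|n IH] a.
  by rewrite expr0 => /pmono_neq0 ->; rewrite mul0r.
rewrite exprS pcoefM => /pconv_neq0[b /uv vb /IH nb].
by rewrite mulrS mulrDl mul1r; lra.
Qed.

Lemma puiseux_unit1 u (v : R) : 0 < v -> (forall b, u b != 0 -> v <= b) ->
  exists q, q * (1 - u) = 1.
Proof.
move=> v0 uv; pose N (c : R) := (Num.trunc (`|c| / v)).+1.
have uN c n : (N c <= n)%N -> (u ^+ n) c = 0.
  move=> Nn; apply/eqP/negPn/negP => /(pcoefX_gt uv); apply/negP; rewrite -ltNge.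
  rewrite -ltr_pdivrMr //; apply: le_lt_trans (_ : `|c| / v < _).
    by rewrite ler_pM2r ?invr_gt0 // ler_norm.
  apply: lt_le_trans (_ : (N c)%:R <= _); last by rewrite ler_nat.
  exact: truncnS_gt.
pose S c := \sum_(n < N c) (u ^+ n) c.
have SE c M : (N c <= M)%N -> S c = (\sum_(n < M) u ^+ n : K) c.
  move=> NM; rewrite pcoef_sum /S.
  rewrite (big_ord_widen _ (fun n => (u ^+ n) c) NM).
  rewrite [RHS](bigID (fun n : 'I_M => (n < N c)%N)) /=.
  rewrite [X in _ + X]big1 ?addr0 // => n; rewrite -leqNgt; exact: uN.
have NN c d : 0 <= d -> d <= c -> (N d <= N c)%N.
  move=> d0 dc; rewrite ltnS; apply: le_truncn.
  by rewrite ler_pM2r ?invr_gt0 // !ger0_norm // (le_trans d0).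
have S0 c : c < 0 -> S c = 0.
  move=> c0; rewrite /S big1 // => n _; apply/eqP/negPn/negP => /(pcoefX_gt uv).
  apply/negP; rewrite -ltNge (lt_le_trans c0) // mulr_ge0 //; exact: ltW.
have SE' c d : d <= c -> S d = (\sum_(n < N c) u ^+ n : K) d.
  move=> dc; have [d0|d0] := leP 0 d; first by apply: SE; exact: NN.
  rewrite S0 // pcoef_sum big1 // => n _; apply/eqP/negPn/negP => /(pcoefX_gt uv).
  apply/negP; rewrite -ltNge (lt_le_trans d0) // mulr_ge0 //; exact: ltW.
have lfS : plf S.
  move=> r; apply: sub_finite_set (@pcoef_lf (\sum_(n < N r) u ^+ n) r) => d [Sd dr].
  by split=> //; move: Sd; rewrite /puiseux_support /= (SE' r).
exists (Puiseux ((plfP _).2 lfS)); apply: puiseux_eq => c.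
rewrite mulrC pcoefM.
transitivity (((1 - u) * \sum_(n < N c) u ^+ n) c).
  rewrite pcoefM /pconv; apply: eq_fsbigr => a _.
  have [ua|ua] := eqVneq ((1 - u) a) 0; first by rewrite ua !mul0r.
  congr (_ * _); apply: SE'; rewrite lerBlDr lerDl.
  have [->//|a0] := eqVneq a 0.
  move: ua; rewrite pcoefD pcoefN pcoef1 (negbTE a0).
  by rewrite sub0r oppr_eq0 => /uv; exact/le_trans/ltW.
rewrite -[1 - u]opprB mulNr -subrX1 opprB pcoefD pcoefN uN ?subr0 //.
Qed.

Lemma puiseux_unit p : p != 0 -> exists q, q * p = 1.
Proof.
move=> p0; have [|m pm mP] := left_finite_min (@pcoef_lf p).
  apply/set0P; apply: contra p0 => /eqP supp0; apply/eqP/puiseux_eq => a.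
  apply/eqP/negPn/negP => pa.
  by have : puiseux_support p a by []; rewrite supp0.
pose t : K := Puiseux ((plfP _).2 (plf_pmono (p m)^-1 (- m))).
have tE a : (t * p) a = (p m)^-1 * p (a + m).
  rewrite pcoefM (@pconvE _ _ a [:: - m]) ?big_seq1 /= /pmono ?eqxx ?opprK //.
  by move=> b /pmono_neq0 -> _; rewrite mem_head.
pose u := 1 - t * p.
have uE a : u a = (a == 0)%:R - (p m)^-1 * p (a + m).
  by rewrite /u pcoefD pcoefN pcoef1 tE.
have u0 a : u a != 0 -> 0 < a.
  rewrite uE; case: (ltrgtP a 0) => // [a0|->].
    have -> : p (a + m) = 0; last by rewrite mulr0 subr0 eqxx.
    by apply/eqP/negPn/negP => /mP; lra.
  by rewrite add0r mulVf // subrr eqxx.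
have [v v0 vP] : exists2 v, 0 < v & forall b, u b != 0 -> v <= b.
  have [S0|/set0P S0] := eqVneq (puiseux_support u) set0; last first.
    by have [v uv vP] := left_finite_min (@pcoef_lf u) S0; exists v => //; exact: u0.
  by exists 1 => // b ub; have : puiseux_support u b by []; rewrite S0.
have [q qP] := puiseux_unit1 v0 vP.
by exists (q * t); rewrite -mulrA -[t * p](subKr 1).
Qed.

Definition pinv p : K := xget 0 [set q | q * p = 1].
Lemma pinvP p : p != 0 -> pinv p * p = 1.
Proof. by move=> /puiseux_unit; exact: xgetPex. Qed.
Lemma pinv0 : pinv 0 = 0.
Proof. by apply: xgetPN => q /= /eqP; rewrite mulr0 eq_sym oner_eq0. Qed.

HB.instance Definition _ := GRing.ComNzRing_isField.Build K pinvP pinv0.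

End PuiseuxRing.

Section Valuation.
Variable R : realType.
Implicit Types p q : puiseux R.

(* The infimum is a minimum when [p != 0] (lemma [pvalP]), and +oo at 0. *)
Definition pval p : \bar R := ereal_inf (EFin @` puiseux_support p).
Arguments pval p%_R.

Lemma pval0 : pval 0 = +oo%E.
Proof.
rewrite /pval; suff -> : puiseux_support (0 : puiseux R) = set0.
  by rewrite image_set0 ereal_inf0.
by apply/seteqP; split=> // a; rewrite /puiseux_support /= eqxx.
Qed.

Lemma pvalP p : p != 0 -> exists a,
  [/\ pval p = a%:E, p a != 0 & forall b, p b != 0 -> a <= b].
Proof.
move=> p0; have [|m pm mP] := left_finite_min (@pcoef_lf _ p).
  apply/set0P; apply: contra p0 => /eqP supp0; apply/eqP/puiseux_eq => a.
  apply/eqP/negPn/negP => pa.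
  by have : puiseux_support p a by []; rewrite supp0.
exists m; split=> //; apply/eqP; rewrite eq_le; apply/andP; split.
  by apply: ereal_inf_lbound; exists m.
by apply/ereal_infP => _ [a pa <-]; rewrite lee_fin mP.
Qed.

Lemma pval_ge p (x : \bar R) :
  (x <= pval p)%E <-> forall a, p a != 0 -> (x <= a%:E)%E.
Proof.
split=> [xp a pa|xP]; last by apply/ereal_infP => _ [a pa <-]; exact: xP.
by apply: le_trans xp _; apply: ereal_inf_lbound; exists a.
Qed.

Lemma pvalN p : pval (- p) = pval p.
Proof.
rewrite /pval; congr (ereal_inf (_ @` _)); apply/funext => a /=.
by rewrite /puiseux_support /= oppr_eq0.
Qed.

Lemma pval_sum_ge I (s : seq I) (F : I -> puiseux R) (P : pred I) (x : \bar R) :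
  (forall i, P i -> (x <= pval (F i))%E) -> (x <= pval (\sum_(i <- s | P i) F i))%E.
Proof.
move=> xF; elim/big_ind: _ => [|p q /pval_ge xp /pval_ge xq|i /xF//].
  by rewrite pval0 leey.
apply/pval_ge => a; rewrite pcoefD; have [->|pa _] := eqVneq (p a) 0; last exact: xp.
by rewrite add0r; exact: xq.
Qed.

Lemma pvalM_ge p q (x : \bar R) :
  (0 <= pval p)%E -> (x <= pval q)%E -> (x <= pval (p * q))%E.
Proof.
move=> /pval_ge p0 /pval_ge xq; apply/pval_ge => c /pconv_neq0[a /p0 a0 /xq].
move=> /le_trans; apply; rewrite lee_fin lerBlDr lerDl.
by rewrite -lee_fin.
Qed.

Lemma pval1_ge0 : (0 <= pval (1 : puiseux R))%E.
Proof. by apply/pval_ge => a /pmono_neq0 ->. Qed.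

Lemma pval_prod_ge0 I (s : seq I) (P : pred I) (F : I -> puiseux R) :
  (forall i, P i -> (0 <= pval (F i))%E) -> (0 <= pval (\prod_(i <- s | P i) F i))%E.
Proof.
move=> F0; elim/big_ind: _ => //; first exact: pval1_ge0.
by move=> p q p0 q0; exact: pvalM_ge.
Qed.

End Valuation.

Section Lattices.
Variables (R : realType) (d : nat).
Local Notation K := (puiseux R).
Implicit Types (A B : 'M[K]_d) (I J : {set 'I_d}) (L : set 'cV[K]_d).

Definition valuation_ring : set K := [set f | (0 <= pval f)%E].

Definition lattice_of A : set 'cV[K]_d :=
  [set A *m v | v in [set v : 'cV[K]_d | forall i, valuation_ring (v i 0)]].

Definition is_representative L A := A \in unitmx /\ L = lattice_of A.

Definition lattices : set (set 'cV[K]_d) := [set L | exists A, is_representative L A].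

(* [A_(I x J)], with rows and columns in increasing order; [conform_mx 0] only
   turns the equality [#|J| = #|I|] into a square matrix. *)
Definition minor A I J : K :=
  \det (conform_mx (0 : 'M_#|I|)
    (mxsub (@enum_val _ (mem I)) (@enum_val _ (mem J)) A)).

Definition min_val_minor A I : \bar R :=
  \big[mine/+oo%E]_(J : {set 'I_d} | #|J| == #|I|) pval (minor A I J).

(* Independent of the chosen representative: lemma [height_representative]. *)
Definition height L I : \bar R :=
  min_val_minor (xget 1%:M [set A | is_representative L A]) I.

Lemma minorE A I J (e : #|I| = #|J|) :
  minor A I J =
  \det (\matrix_(i < #|I|, j < #|I|) A (enum_val i) (enum_val (cast_ord e j))).
Proof.
rewrite /minor.
pose M k (f : 'I_k -> 'I_d) :=
  conform_mx (0 : 'M_#|I|) (mxsub (@enum_val _ (mem I)) f A).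
have ME k (e' : #|I| = k) (f : 'I_k -> 'I_d) :
    M k f = \matrix_(i, j) A (enum_val i) (f (cast_ord e' j)).
  case: k / e' f => f; rewrite /M conform_mx_id.
  by apply/matrixP => i j; rewrite !mxE cast_ord_id.
by congr (\det _); rewrite -/(M _ _) (ME _ e).
Qed.

Lemma pval_det_mul_ge k (M : 'M[K]_(k, d)) (N : 'M[K]_(d, k)) (x : \bar R) :
  (forall i j, (0 <= pval (N i j))%E) ->
  (forall f : 'I_k -> 'I_d, injective f -> (x <= pval (\det (colsub f M)))%E) ->
  (x <= pval (\det (M *m N)))%E.
Proof.
move=> N0 xM.
have -> : \det (M *m N) =
    \sum_(f : {ffun 'I_k -> 'I_d}) (\prod_i N (f i) i) * \det (colsub f M).
  rewrite -[LHS]det_tr [LHS]/determinant.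
  under eq_bigr => s _.
    under eq_bigr do rewrite !mxE.
    rewrite bigA_distr_bigA big_distrr /=. over.
  rewrite exchange_big /=; apply: eq_bigr => f _.
  rewrite -[\det _]det_tr /determinant big_distrr /=; apply: eq_bigr => s _.
  rewrite mulrCA; congr (_ * _); rewrite -big_split /=; apply: eq_bigr => i _.
  by rewrite !mxE mulrC.
apply: pval_sum_ge => f _.
have [/injectiveP finj|/injectivePn [i [j ij fij]]] := boolP (injectiveb f).
  apply: pvalM_ge; first exact: pval_prod_ge0.
  exact: xM.
rewrite -det_tr (determinant_alternate ij) ?mulr0 ?pval0 ?leey // => l.
by rewrite !mxE fij.
Qed.

Lemma min_val_minor_inj A I (f : 'I_#|I| -> 'I_d) : injective f ->
  (min_val_minor A I <= pval (\det (mxsub (@enum_val _ (mem I)) f A)))%E.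
Proof.
move=> finj; pose J := [set f j | j : 'I_#|I|].
have cJ : #|J| = #|I| by rewrite card_imset // card_ord.
pose g j : 'I_d := @enum_val _ (mem J) (cast_ord (esym cJ) j).
have fg j : f j \in codom g.
  have fJ : f j \in J by exact: imset_f.
  apply/codomP; exists (cast_ord cJ (enum_rank_in fJ (f j))).
  by rewrite /g cast_ordK enum_rankK_in.
pose s j := iinv (fg j).
have gs j : g (s j) = f j by exact: f_iinv.
have sinj : injective s by move=> i j /(congr1 g); rewrite !gs => /finj.
have -> : mxsub (@enum_val _ (mem I)) f A =
    col_perm (perm sinj) (\matrix_(i, j) A (enum_val i) (g j)).
  by apply/matrixP => i j; rewrite !mxE permE gs.
rewrite col_permE det_mulmx det_perm.
have -> : \det (\matrix_(i < #|I|, j < #|I|) A (enum_val i) (g j)) = minor A I J.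
  by rewrite (minorE _ (esym cJ)).
have -> : pval (minor A I J * (-1) ^+ (perm sinj)^-1%g) = pval (minor A I J).
  by rewrite mulrC; case: (odd_perm _); rewrite ?expr0 ?expr1 ?mul1r ?mulN1r ?pvalN.
by apply: bigmin_le_cond; rewrite cJ.
Qed.

Lemma min_val_minor_mul A (U : 'M[K]_d) I : (forall i j, (0 <= pval (U i j))%E) ->
  (min_val_minor A I <= min_val_minor (A *m U) I)%E.
Proof.
move=> U0; apply: le_bigmin => [|J /eqP cJ]; first exact: leey.
rewrite (minorE _ (esym cJ)).
have -> : \matrix_(i < #|I|, j < #|I|) (A *m U) (enum_val i) (enum_val (cast_ord (esym cJ) j)) =
   rowsub (@enum_val _ (mem I)) A *m colsub (fun j => enum_val (cast_ord (esym cJ) j)) U.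
  apply/matrixP => i j; rewrite !mxE; apply: eq_bigr => l _; by rewrite !mxE.
apply: pval_det_mul_ge => [i j|f finj]; first by rewrite mxE.
apply: le_trans (min_val_minor_inj A finj) _.
rewrite le_eqVlt; apply/orP; left; apply/eqP; congr (pval (\det _)).
by apply/matrixP => i j; rewrite !mxE.
Qed.

Lemma lattice_of_sub A B : lattice_of A `<=` lattice_of B ->
  exists2 U : 'M[K]_d, (forall i j, (0 <= pval (U i j))%E) & A = B *m U.
Proof.
move=> AB; have uP j : exists u : 'cV[K]_d,
    (forall i, (0 <= pval (u i 0%R))%E) /\ B *m u = col j A.
  have [|u u0 Bu] := AB (col j A); last by exists u.
  exists (delta_mx j 0); last by rewrite colE.
  move=> i; rewrite /valuation_ring /= mxE eqxx andbT.
  by case: (i == j); rewrite ?pval0 ?leey ?pval1_ge0.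
have [u uE] := choice uP; exists (\matrix_(i, j) u j i 0).
  by move=> i j; rewrite mxE; have [] := uE j.
apply/matrixP => i j; have [_ /matrixP/(_ i 0)] := uE j.
by rewrite !mxE => <-; apply: eq_bigr => l _; rewrite mxE.
Qed.

Lemma height_representative L A I :
  is_representative L A -> height L I = min_val_minor A I.
Proof.
move=> LA; have [_] := LA.
have [] : is_representative L (xget 1%:M [set A | is_representative L A]).
  by apply: (@xgetPex _ _ [set A | is_representative L A]); exists A.
rewrite /height; set B := xget _ _ => _ -> AB.
have [U U0 AU] : exists2 U : 'M[K]_d, (forall i j, (0 <= pval (U i j))%E) & A = B *m U.
  by apply: lattice_of_sub; rewrite AB.
have [V V0 BV] : exists2 U : 'M[K]_d, (forall i j, (0 <= pval (U i j))%E) & B = A *m U.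
  by apply: lattice_of_sub; rewrite AB.
apply/eqP; rewrite eq_le; apply/andP; split.
  by rewrite [X in (_ <= min_val_minor X _)%E]AU min_val_minor_mul.
by rewrite [X in (_ <= min_val_minor X _)%E]BV min_val_minor_mul.
Qed.

End Lattices.

Section Cones.
Variables (R : realType) (V : vectType R).
Implicit Types (C F : set V) (U L : {vspace V}).

Definition minkowski_sum C F : set V := [set c + f | c in C & f in F].

Definition is_lineality_space C L :=
  [set` L] `<=` C /\ forall U, [set` U] `<=` C -> (U <= L)%VS.

(* Such a space exists as soon as [C] is closed under addition and contains 0. *)
Definition lineality_space C : {vspace V} := xget 0%VS (is_lineality_space C).

Definition is_linear_span C U :=
  C `<=` [set` U] /\ forall L, C `<=` [set` L] -> (U <= L)%VS.

Definition linear_span C : {vspace V} := xget 0%VS (is_linear_span C).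

Definition cone_dim C : nat := \dim (linear_span C).

Definition polyhedral_cone C := exists s : seq 'Hom(V, R^o),
  C = [set v | forall l, l \in s -> 0 <= (l v : R)].

Definition pointed C := is_lineality_space C 0%VS.

Definition is_face C F := exists l : 'Hom(V, R^o),
  (forall v, C v -> 0 <= (l v : R)) /\ F = C `&` [set v | l v = 0].

Definition polyhedral_fan (Phi : set (set V)) :=
  [/\ finite_set Phi /\ Phi !=set0,
      forall C, Phi C -> polyhedral_cone C,
      forall C F, Phi C -> is_face C F -> Phi F
    & forall C D, Phi C -> Phi D -> is_face C (C `&` D) /\ is_face D (C `&` D)].

Definition fan_support (Phi : set (set V)) : set V := \bigcup_(C in Phi) C.

Definition fan_dim_is (Phi : set (set V)) (n : nat) :=
  (forall C, Phi C -> (cone_dim C <= n)%N) /\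
  exists C, Phi C /\ cone_dim C = n.

Lemma lineality_spaceP C : C 0 -> (forall u v, C u -> C v -> C (u + v)) ->
  is_lineality_space C (lineality_space C).
Proof.
move=> C0 CD; apply: xgetPex.
pose P n := `[< exists U, [set` U] `<=` C /\ \dim U = n >].
have P0 : exists n, P n.
  by exists 0; apply/asboolP; exists 0%VS; rewrite dimv0; split=> // v /=; 
    rewrite memv0 => /eqP ->.
have Pub n : P n -> (n <= \dim {:V})%N.
  by move=> /asboolP[U [_ <-]]; apply/dimvS/subvf.
case: (ex_maxnP P0 Pub) => n /asboolP[L [LC Ln] nmax]; exists L; split=> // U UC.
have LUC : [set` (L + U)%VS] `<=` C.
  by move=> _ /memv_addP[u /LC Cu [v /UC Cv ->]]; exact: CD.
have /nmax LUn : P (\dim (L + U)) by apply/asboolP; exists (L + U)%VS.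
have : L == (L + U)%VS by rewrite eqEdim addvSl Ln.
by move=> /eqP ->; exact: addvSr.
Qed.

Lemma linear_spanP C : is_linear_span C (linear_span C).
Proof.
apply: xgetPex.
pose P n := `[< exists U, C `<=` [set` U] /\ \dim U = n >].
have P0 : exists n, P n.
  by exists (\dim {:V}); apply/asboolP; exists {:V}%VS; split=> // v _ /=; exact: memvf.
case: (ex_minnP P0) => n /asboolP[U [CU Un] nmin]; exists U; split=> // L CL.
have CUL : C `<=` [set` (U :&: L)%VS].
  by move=> v Cv /=; rewrite memv_cap; apply/andP; split; [exact: CU|exact: CL].
have /nmin ULn : P (\dim (U :&: L)) by apply/asboolP; exists (U :&: L)%VS.
have : (U :&: L)%VS == U by rewrite eqEdim capvSl Un.
by move=> /eqP <-; exact: capvSr.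
Qed.

End Cones.

Section Entropy.
Variables (R : realType) (d : nat).
Implicit Types I J : {set 'I_d}.

Definition nonempty_set := {I : {set 'I_d} | I != finset.set0}.

(* R^(2^d - 1): vectors indexed by subsets, with the (zero) coordinate at the
   empty set dropped. *)
Definition setvec := {ffun nonempty_set -> R^o}.

Definition at_set (x : setvec) I : R := oapp x 0 (insub I : option nonempty_set).

Definition supermodular_cone : set setvec :=
  [set x | forall I J,
     at_set x I + at_set x J <= at_set x (I :&: J)%SET + at_set x (I :|: J)%SET].

Definition entropy_map (L : set 'cV[puiseux R]_d) : setvec :=
  [ffun I : nonempty_set => fine (height L (val I))].

Definition entropy_image : set setvec := entropy_map @` @lattices R d.

Lemma at_set0 x : at_set x finset.set0 = 0.
Proof. by rewrite /at_set insubF // eqxx. Qed.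

Lemma at_setE x (I : nonempty_set) : at_set x (val I) = x I.
Proof. by rewrite /at_set valK. Qed.

Lemma at_set_linear I : linear (at_set^~ I : setvec -> R^o).
Proof.
move=> a x y; rewrite /at_set; case: insubP => [J _ _|_] /=.
  by rewrite !ffunE.
by rewrite scaler0 addr0.
Qed.

Lemma at_setD x y I : at_set (x + y) I = at_set x I + at_set y I.
Proof. by have := at_set_linear I 1 x y; rewrite !scale1r. Qed.
Lemma at_setZ a x I : at_set (a *: x) I = a * at_set x I.
Proof.
have := at_set_linear I a x 0; rewrite addr0 => ->.
by have := at_set_linear I (-1) x x; rewrite !scaleN1r !addNr => ->; rewrite addr0.
Qed.
Lemma at_setN x I : at_set (- x) I = - at_set x I.
Proof. by rewrite -scaleN1r at_setZ mulN1r. Qed.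
Lemma at_set_vec0 I : at_set 0 I = 0.
Proof. by rewrite -(scale0r 0) at_setZ mul0r. Qed.

Lemma setvec_eq x y : (forall I, at_set x I = at_set y I) -> x = y.
Proof. by move=> xy; apply/ffunP => I; rewrite -!at_setE. Qed.

Lemma supermodular_lineality :
  is_lineality_space supermodular_cone (lineality_space supermodular_cone).
Proof.
apply: lineality_spaceP => [I J|x y xS yS I J]; first by rewrite !at_set_vec0.
by rewrite !at_setD; have := xS I J; have := yS I J; lra.
Qed.

Lemma mem_lineality x : x \in lineality_space supermodular_cone <->
  forall I J, at_set x I + at_set x J = at_set x (I :&: J)%SET + at_set x (I :|: J)%SET.
Proof.
have [LS Lmax] := supermodular_lineality; split=> [xL I J|xM].
  have := LS x xL I J; have := LS (- x); rewrite /= memvN => /(_ xL I J).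
  by rewrite !at_setN; lra.
suff /Lmax : [set` <[x]>%VS] `<=` supermodular_cone by rewrite -memvE.
move=> _ /vlineP[k ->] I J; rewrite !at_setZ -!mulrDr.
by rewrite (xM I J).
Qed.

Lemma lineality_sum x I : x \in lineality_space supermodular_cone ->
  at_set x I = \sum_(i in I) at_set x [set i]%SET.
Proof.
move=> /mem_lineality xM; have [n] := ubnP #|I|; elim: n I => // n IH I In.
have [->|/set0Pn[i iI]] := eqVneq I finset.set0; first by rewrite at_set0 big_set0.
have := xM [set i]%SET (I :\ i)%SET; rewrite finset.setD1K // (big_setD1 i) //=.
have -> : ([set i] :&: (I :\ i))%SET = finset.set0.
  by apply/setP => j; rewrite !inE; case: eqP.
rewrite at_set0 add0r => <-; congr (_ + _); apply: IH.
by move: In; rewrite (cardsD1 i) iI.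
Qed.

Lemma sum_lineality (a : 'I_d -> R) x :
  (forall I, at_set x I = \sum_(i in I) a i) ->
  x \in lineality_space supermodular_cone.
Proof.
move=> xa; apply/mem_lineality => I J; rewrite !xa.
rewrite [X in _ = _ + X](big_setID I) /= [X in _ + X = _](big_setID I) /=.
rewrite finset.setUK finset.setDUl finset.setDv finset.set0U (finset.setIC J).
by rewrite addrCA.
Qed.

End Entropy.

Section Dimension3.
Variable R : realType.
Local Notation V := (setvec R 3).

Definition i1 : 'I_3 := @Ordinal 3 0 isT.
Definition i2 : 'I_3 := @Ordinal 3 1 isT.
Definition i3 : 'I_3 := @Ordinal 3 2 isT.

Definition x1 (v : V) : R := at_set v [set i1]%SET.
Definition x2 (v : V) : R := at_set v [set i2]%SET.
Definition x3 (v : V) : R := at_set v [set i3]%SET.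
Definition x12 (v : V) : R := at_set v [set i1; i2]%SET.
Definition x13 (v : V) : R := at_set v [set i1; i3]%SET.
Definition x23 (v : V) : R := at_set v [set i2; i3]%SET.
Definition x123 (v : V) : R := at_set v [set: 'I_3]%SET.

Definition lineality3 : {vspace V} := lineality_space (@supermodular_cone R 3).

Definition W_eqs (v : V) : R^o * R^o * R^o := (x1 v, x12 v, x123 v).

Lemma W_eqs_linear : linear W_eqs.
Proof. by move=> a u v; congr (_, _, _); apply: at_set_linear. Qed.
HB.instance Definition _ := GRing.isLinear.Build R V _ _ W_eqs W_eqs_linear.

(* The subspace [x1 = x12 = x123 = 0]. *)
Definition W : {vspace V} := lker (linfun W_eqs).

Lemma mem_W v : v \in W <-> [/\ x1 v = 0, x12 v = 0 & x123 v = 0].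
Proof.
rewrite memv_ker lfunE; split=> [/eqP[-> -> ->]//|[v1 v2 v3]].
by rewrite /= /W_eqs v1 v2 v3.
Qed.

Lemma sum_i12 (F : 'I_3 -> R) : \sum_(i in [set i1; i2]%SET) F i = F i1 + F i2.
Proof. by rewrite big_setU1 ?inE // big_set1. Qed.

Lemma sum_i123 (F : 'I_3 -> R) :
  \sum_(i in [set: 'I_3]%SET) F i = F i1 + F i2 + F i3.
Proof.
rewrite (eq_bigl predT) => [|i]; last by rewrite !inE.
rewrite !big_ord_recl big_ord0 addr0 addrA.
by congr (F _ + F _ + F _); apply: val_inj.
Qed.

Lemma ord3P (P : 'I_3 -> Prop) : P i1 -> P i2 -> P i3 -> forall i, P i.
Proof.
move=> p1 p2 p3 [[|[|[|i]]] ilt] //.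
- by rewrite (_ : Ordinal _ = i1) //; apply: val_inj.
- by rewrite (_ : Ordinal _ = i2) //; apply: val_inj.
- by rewrite (_ : Ordinal _ = i3) //; apply: val_inj.
Qed.

Lemma W_lineality3_direct : (W :&: lineality3 = 0)%VS.
Proof.
apply/eqP; rewrite -subv0; apply/subvP => v; rewrite memv_cap memv0 => /andP[].
move=> /mem_W[v1 v12 v123] vL.
have sE I := lineality_sum I vL.
apply/eqP/setvec_eq => I; rewrite sE at_set_vec0 big1 // => i _.
move: v1 v12 v123; rewrite /x1 /x12 /x123 (sE [set i1; i2]%SET) (sE [set: _]%SET) sum_i12 sum_i123 => v1 v12 v123.
by move: i; apply: ord3P; lra.
Qed.

Lemma W_lineality3_onto (t : R^o * R^o * R^o) :
  exists2 v, v \in lineality3 & W_eqs v = t.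
Proof.
case: t => -[p q] r.
pose a (i : 'I_3) : R := if i == i1 then p else if i == i2 then q - p else r - q.
pose v : V := [ffun I : nonempty_set 3 => \sum_(i in val I) a i].
have vE I : at_set v I = \sum_(i in I) a i.
  rewrite /at_set; case: insubP => [J _ <-|/negPn/eqP->] /=; first by rewrite ffunE.
  by rewrite big_set0.
exists v; first exact: sum_lineality vE.
rewrite /W_eqs /x1 /x12 /x123 !vE big_set1 sum_i12 sum_i123 /a /=.
by congr (_, _, _); lra.
Qed.

Lemma dim_lineality3 : \dim lineality3 = 3%N.
Proof.
rewrite -(limg_ker_dim (linfun W_eqs) lineality3) capvC W_lineality3_direct dimv0.
have -> : (linfun W_eqs @: lineality3 = fullv)%VS.
  apply/eqP; rewrite eqEsubv subvf; apply/subvP => t _.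
  have [v vL <-] := W_lineality3_onto t.
  by apply/memv_imgP; exists v; rewrite ?lfunE.
by rewrite dimvf.
Qed.

Lemma W_lineality3_full : (W + lineality3 = fullv)%VS.
Proof.
apply/eqP; rewrite eqEsubv subvf; apply/subvP => v _.
have [u uL uv] := W_lineality3_onto (W_eqs v).
apply/memv_addP; exists (v - u); last by exists u; rewrite ?subrK.
by rewrite memv_ker lfunE linearB /= uv subrr.
Qed.

(* Projection onto [W] parallel to [lineality3], see [W_lineality3_direct] and
   [W_lineality3_full]. *)
Definition projW : V -> V := daddv_pi W lineality3.

Definition entropy_proj : set V := projW @` @entropy_image R 3.
Definition supermodular_proj : set V := projW @` @supermodular_cone R 3.

Definition sigma1 : set V := [set v | v \in W /\
  let: w := x2 v in let: x := x3 v in let: y := x13 v in let: z := x23 v in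
  [/\ w <= 0, x <= w + y, y <= 0 & z = x]].

Definition sigma2 : set V := [set v | v \in W /\
  let: w := x2 v in let: x := x3 v in let: y := x13 v in let: z := x23 v in
  [/\ w <= 0, x <= y, y <= 0, y + w <= x & z = y + w]].

Definition sigma3 : set V := [set v | v \in W /\
  let: w := x2 v in let: x := x3 v in let: y := x13 v in let: z := x23 v in
  [/\ w <= 0, y <= 0, x = y + w, z <= w & x <= z]].

(* A cone is a face of itself: the three cones are the maximal members. *)
Definition entropy_fan : set (set V) :=
  [set F | [\/ is_face sigma1 F, is_face sigma2 F | is_face sigma3 F]].

End Dimension3.

(* Main.v *)
From mathcomp Require Import all_boot perm.
Require Import Defs.
From HB Require Import structures.
From mathcomp Require Import all_boot all_order all_algebra.
From mathcomp Require Import mathcomp_extra boolp classical_sets functions.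
From mathcomp Require Import cardinality reals ereal.
From mathcomp Require Import ring lra.

Set Implicit Arguments.
Unset Strict Implicit.
Unset Printing Implicit Defensive.

Import Order.TTheory GRing.Theory Num.Theory.

Local Open Scope classical_set_scope.
Local Open Scope ring_scope.

Arguments pval {R} p%_R.

(** The image of the entropy map is cut out of the supermodular cone by one
    tropical relation: among [x1 + x23], [x2 + x13] and [x3 + x12] the minimum
    is attained at least twice.

    Supermodularity is the ultrametric inequality applied to two polynomial
    identities between minors: a 2 x 2 minor as a combination of products of entries
    ([entropy_super1]) and the Desnanot-Jacobi identity ([entropy_super2]). The
    tropical relation ([entropy_incidence]) comes from the Laplace expansion of
    the determinant along a column, which ties each row [i] to the 2 x 2 minors
    of the two other rows. On the complement [W] of the lineality space the
    three quantities become [z], [w + y] and [x], and the cones [sigma1],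
    [sigma2], [sigma3] are the three ways for two of them to realize the minimum
    ([entropy_proj_sub]). Conversely, every point of the three cones is the entropy
    vector of a lower unitriangular matrix whose entries are sums of at most
    two monomials ([entropy_lowmx], [entropy_proj_sup]). Multiplying the rows of
    a representative by powers of [t] translates the entropy vector by an
    arbitrary element of the lineality space ([entropy_image_lineality]), so
    that the projection to [W] is the intersection with [W] ([projW_image]).

    The projection of the supermodular cone is the cone over a triangular
    bipyramid. Each of the three cones is spanned by both poles and by one of
    the equatorial vertices: they are the three triangles around the axis. The
    only relation between the five rays involves all of them
    ([rays_relation]), so any two of the three cones are spanned by parts of one
    free family. This suffices for their faces to form a fan
    ([simplicial_fan]), since for such cones faces and intersections
    correspond to subsets of the family and their intersections. *)

(** * The valuation *)
Section PuiseuxValuation.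
Variable R : realType.
Implicit Types (p q : puiseux R) (a b x : R).

Lemma pval_leP p a : (pval p <= a%:E)%E <-> exists2 b, p b != 0 & b <= a.
Proof.
split=> [pa|[b pb ba]]; last first.
  by apply: le_trans (_ : b%:E <= _)%E; [exact/(pval_ge p (pval p)).1|rewrite lee_fin].
have p0 : p != 0 by apply: contraTneq pa => ->; rewrite pval0 -ltNge ltry.
have [b [pE pb _]] := pvalP p0.
by exists b => //; rewrite -lee_fin -pE.
Qed.

Lemma pval_eqP p a :
  pval p = a%:E <-> p a != 0 /\ forall b, p b != 0 -> a <= b.
Proof.
split=> [pE|[pa ap]].
  have p0 : p != 0 by apply: contra_eqN pE => /eqP ->; rewrite pval0.
  by have [b [+ pb bp]] := pvalP p0; rewrite pE => -[->].
apply/eqP; rewrite eq_le; apply/andP; split.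
  by apply/pval_leP; exists a.
by apply/pval_ge => b /ap; rewrite lee_fin.
Qed.

Lemma pval_geD p q (x : \bar R) :
  (x <= pval p)%E -> (x <= pval q)%E -> (x <= pval (p + q))%E.
Proof.
move=> /pval_ge xp /pval_ge xq; apply/pval_ge => a; rewrite pcoefD.
have [->|/xp//] := eqVneq (p a) 0.
by rewrite add0r; exact: xq.
Qed.

Lemma pval_geB p q (x : \bar R) :
  (x <= pval p)%E -> (x <= pval q)%E -> (x <= pval (p - q))%E.
Proof. by move=> xp xq; apply: pval_geD; rewrite ?pvalN. Qed.

Lemma pval_geM p q a b :
  (a%:E <= pval p)%E -> (b%:E <= pval q)%E -> ((a + b)%:E <= pval (p * q))%E.
Proof.
move=> /pval_ge ap /pval_ge bq; apply/pval_ge => c; rewrite pcoefM.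
move=> /pconv_neq0[d /ap + /bq]; rewrite !lee_fin; lra.
Qed.

Lemma pvalM p q a b :
  pval p = a%:E -> pval q = b%:E -> pval (p * q) = (a + b)%:E.
Proof.
move=> pE qE; have /pval_eqP[pa ap] := pE; have /pval_eqP[qb bq] := qE.
apply/pval_eqP; split; last first.
  move=> c pqc; rewrite -lee_fin; move: c pqc.
  by apply/pval_ge; apply: pval_geM; rewrite ?pE ?qE.
rewrite pcoefM (@pconvE _ _ _ _ [:: a]) // ?big_seq1.
  by rewrite addrAC subrr add0r mulf_neq0.
move=> c /ap ac /bq bc; rewrite inE; apply/eqP.
by apply/le_anti; rewrite ac andbT; lra.
Qed.

Definition tpow a : puiseux R := Puiseux ((plfP _).2 (plf_pmono 1 a)).

Lemma tpowE a b : tpow a b = (b == a)%:R.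
Proof. by rewrite /= /pmono; case: eqP. Qed.

Lemma pval_tpow a : pval (tpow a) = a%:E.
Proof.
apply/pval_eqP; split=> [|b]; rewrite tpowE ?eqxx ?oner_neq0 //.
by have [->|_] := eqVneq b a; rewrite ?eqxx.
Qed.

Lemma tpow_neq0 a : tpow a != 0.
Proof. by apply: contra_eqN (pval_tpow a) => /eqP ->; rewrite pval0. Qed.

Lemma tpowD a b : tpow (a + b) = tpow a * tpow b.
Proof.
apply: puiseux_eq => c; rewrite pcoefM (@pconvE _ _ _ _ [:: a]) // ?big_seq1.
  by rewrite !tpowE eqxx mul1r subr_eq addrC.
by move=> d; rewrite tpowE inE; case: (d == a); rewrite ?eqxx.
Qed.

Lemma tpow0 : tpow 0 = 1.
Proof. exact: puiseux_eq. Qed.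

(** Both leading coefficients are positive, so they cannot cancel. *)
Lemma pval_tpowD a b : a <= b -> pval (tpow a + tpow b) = a%:E.
Proof.
move=> ab; apply/pval_eqP; split=> [|c]; rewrite pcoefD !tpowE.
  rewrite eqxx; case: (a == b); last by rewrite addr0 oner_neq0.
  by rewrite -mulr2n pnatr_eq0.
by have [->//|_] := eqVneq c a; have [->//|_] := eqVneq c b; rewrite addr0 eqxx.
Qed.

End PuiseuxValuation.

(** * Heights through minors with arbitrarily enumerated rows *)
Section Heights.
Variables (R : realType) (d : nat).
Local Notation K := (puiseux R).
Implicit Types (A : 'M[K]_d) (I : {set 'I_d}).

Lemma pval_det_row_perm k (s : 'S_k) (M : 'M[K]_k) :
  pval (\det (row_perm s M)) = pval (\det M).
Proof.
rewrite row_permE det_mulmx det_perm.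
by case: (odd_perm _); rewrite ?expr1 ?mulN1r ?pvalN ?expr0 ?mul1r.
Qed.

Lemma pval_det_col_perm k (s : 'S_k) (M : 'M[K]_k) :
  pval (\det (col_perm s M)) = pval (\det M).
Proof. by rewrite -det_tr tr_col_perm pval_det_row_perm det_tr. Qed.

Lemma pval_det_mxsub A (r f : 'I_d -> 'I_d) : injective r -> injective f ->
  pval (\det (mxsub r f A)) = pval (\det A).
Proof.
move=> rI fI; have -> : mxsub r f A = row_perm (perm rI) (col_perm (perm fI) A).
  by apply/matrixP => i j; rewrite !mxE !permE.
by rewrite pval_det_row_perm pval_det_col_perm.
Qed.

(** The valuation of a minor does not depend on the order in which its rows are
    listed, so heights of explicit sets can be computed with explicit lists of
    rows in place of the abstract enumeration of a finite set. *)
Lemma pval_det_enum A k (r : 'I_k -> 'I_d) (f : 'I_k -> 'I_d) I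
    (kI : #|I| = k) : injective r -> (forall i, r i \in I) ->
  pval (\det (mxsub r f A)) =
  pval (\det (mxsub (@enum_val _ (mem I)) (fun i => f (cast_ord kI i)) A)).
Proof.
case: k / kI r f => r f rI rIn.
pose s i := enum_rank_in (rIn i) (r i).
have es i : enum_val (s i) = r i by rewrite enum_rankK_in.
have sI : injective s by move=> i j /(congr1 enum_val); rewrite !es => /rI.
rewrite -[RHS](pval_det_row_perm (perm sI)); congr (pval (\det _)).
by apply/matrixP => i j; rewrite !mxE !permE es cast_ord_id.
Qed.

Variables (A : 'M[K]_d) (k : nat) (r : 'I_k -> 'I_d) (I : {set 'I_d}).
Hypotheses (kI : #|I| = k) (rI : injective r) (rIn : forall i, r i \in I).

Lemma min_val_minor_le (f : 'I_k -> 'I_d) :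
  (min_val_minor A I <= pval (\det (mxsub r f A)))%E.
Proof.
have [/injectiveP fI|/injectivePn [i [j ij fij]]] := boolP (injectiveb f).
  rewrite (pval_det_enum A f kI) //; apply: min_val_minor_inj.
  by move=> i j /fI/cast_ord_inj.
rewrite -det_tr (determinant_alternate ij) ?pval0 ?leey // => l.
by rewrite !mxE fij.
Qed.

Lemma min_val_minor_attained :
  exists f : 'I_k -> 'I_d, min_val_minor A I = pval (\det (mxsub r f A)).
Proof.
have [J /eqP JI ->] : {J | J \in [pred J : {set 'I_d} | #|J| == #|I|] &
    min_val_minor A I = pval (minor A I J)}.
  exact: (@eq_bigmin _ _ _ +oo%E I (fun J => #|J| == #|I|)
    (fun J => pval (minor A I J)) (eqxx _) (fun J _ => leey _)).
pose f i : 'I_d := enum_val (cast_ord (esym JI) (cast_ord (esym kI) i)).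
exists f; rewrite (pval_det_enum A f kI rI rIn) (minorE _ (esym JI)).
congr (pval (\det _)); apply/matrixP => i j; rewrite !mxE.
by rewrite /f cast_ordK.
Qed.

Lemma min_val_minor_eq (x : \bar R) :
  (forall f : 'I_k -> 'I_d, (x <= pval (\det (mxsub r f A)))%E) ->
  (exists f : 'I_k -> 'I_d, (pval (\det (mxsub r f A)) <= x)%E) ->
  min_val_minor A I = x.
Proof.
move=> xle [f fx]; apply/eqP; rewrite eq_le (le_trans (min_val_minor_le f) fx) /=.
by have [g ->] := min_val_minor_attained; exact: xle.
Qed.

End Heights.

Section LatticeEntropy.
Variables (R : realType) (d : nat).
Local Notation K := (puiseux R).
Implicit Types (A : 'M[K]_d) (I : {set 'I_d}).

(** The rows of [A] in [I] are independent, so some maximal minor on them is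
    nonzero. *)
Lemma min_val_minor_fin A I : A \in unitmx ->
  exists h : R, min_val_minor A I = h%:E.
Proof.
move=> Au; pose M := rowsub (@enum_val _ (mem I)) A.
have Mfree : row_free M.
  apply/row_freeP; exists (colsub (@enum_val _ (mem I)) (invmx A)).
  rewrite -mxsub_mul mulmxV //; apply/matrixP => i j.
  by rewrite !mxE (inj_eq enum_val_inj).
have Mfull : row_full M^T by rewrite /row_full mxrank_tr.
have := fullrowsub_unit Mfull; rewrite unitmxE unitfE => Nu.
have {}Nu : \det (mxsub (@enum_val _ (mem I)) (fullrankfun Mfull) A) != 0.
  apply: contraNneq Nu => N0; rewrite -det_tr; apply/eqP; rewrite -[RHS]N0.
  by congr (\det _); apply/matrixP => i j; rewrite !mxE.
have [a [aE _ _]] := pvalP Nu.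
have eI : injective (@enum_val _ (mem I)) by exact: enum_val_inj.
have := min_val_minor_le A (erefl #|I|) eI (@enum_valP _ _) (fullrankfun Mfull).
rewrite aE.
have [f ->] := min_val_minor_attained A (erefl #|I|) eI (@enum_valP _ _).
set D := \det _; have [->|/pvalP[b [-> _ _]] _] := eqVneq D 0.
  by rewrite pval0 leNgt ltry.
by exists b.
Qed.

Definition entropy_of A : setvec R d := entropy_map (lattice_of A).

Lemma entropy_imageP (v : setvec R d) :
  entropy_image v <-> exists2 A, A \in unitmx & v = entropy_of A.
Proof.
split=> [[L [A [Au ->]] <-]|[A Au ->]]; first by exists A.
by exists (lattice_of A) => //; exists A.
Qed.

Lemma at_entropy_of A I : A \in unitmx -> I != finset.set0 ->
  (at_set (entropy_of A) I)%:E = min_val_minor A I.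
Proof.
move=> Au I0; rewrite /at_set insubT /= ffunE /=.
rewrite (@height_representative _ _ _ A) //.
by have [h ->] := min_val_minor_fin I Au.
Qed.

(** The minor on rows [I] is multiplied by the product of the scaling factors
    of these rows. *)
Lemma min_val_minor_scale A I (a : 'I_d -> R) : A \in unitmx ->
  min_val_minor (diag_mx (\row_i tpow (a i)) *m A) I =
  (min_val_minor A I + (\sum_(i in I) a i)%:E)%E.
Proof.
move=> Au; have eI : injective (@enum_val _ (mem I)) by exact: enum_val_inj.
set e := @enum_val _ (mem I) in eI; have eP : forall i, e i \in I by exact: enum_valP.
set s := \sum_(i in I) _.
have detE f : \det (mxsub e f (diag_mx (\row_i tpow (a i)) *m A)) =
    tpow s * \det (mxsub e f A).
  have -> : mxsub e f (diag_mx (\row_i tpow (a i)) *m A) =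
      diag_mx (\row_i tpow (a (e i))) *m mxsub e f A.
    by apply/matrixP => i j; rewrite !mul_diag_mx !mxE.
  rewrite det_mulmx det_diag; congr (_ * _).
  under eq_bigr do rewrite mxE.
  rewrite /s (big_enum_val a) /= -/e.
  apply: (big_rec2 (fun x y => x = tpow y)) => [|i x y _ ->]; by rewrite ?tpow0 ?tpowD.
have [h hE] := min_val_minor_fin I Au; rewrite hE -EFinD.
apply: (min_val_minor_eq (erefl #|I|) eI eP) => [f|].
  rewrite detE addrC; apply: pval_geM; rewrite ?pval_tpow // -hE.
  exact: min_val_minor_le.
have [f fE] := min_val_minor_attained A (erefl #|I|) eI eP.
exists f; rewrite detE addrC.
by rewrite (pvalM (pval_tpow s) (etrans (esym fE) hE)).
Qed.

Lemma entropy_image_lineality (u v : setvec R d) : entropy_image u ->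
  v \in lineality_space (@supermodular_cone R d) -> entropy_image (u + v).
Proof.
move=> /entropy_imageP[A Au ->] vL; apply/entropy_imageP.
pose a i := at_set v [set i]%SET.
have Du : diag_mx (\row_i tpow (a i)) *m A \in unitmx.
  rewrite unitmx_mul Au andbT unitmxE det_diag unitfE.
  by apply/prodf_neq0 => i _; rewrite mxE tpow_neq0.
exists (diag_mx (\row_i tpow (a i)) *m A) => //; apply: setvec_eq => I.
have [->|I0] := eqVneq I finset.set0; first by rewrite !at_set0.
apply: EFin_inj; rewrite at_entropy_of // min_val_minor_scale //.
by rewrite at_setD EFinD (lineality_sum I vL) at_entropy_of.
Qed.

End LatticeEntropy.

(** * Heights of a lattice of rank three *)
Section SmallMinors.
Variable K : comNzRingType.

Definition minor2 m n (A : 'M[K]_(m, n)) i j a b := A i a * A j b - A i b * A j a.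

Definition minor3 m n (A : 'M[K]_(m, n)) i j k a b c :=
  A i a * minor2 A j k b c - A i b * minor2 A j k a c + A i c * minor2 A j k a b.

Lemma det_mxsub1 m n (A : 'M[K]_(m, n)) (r : 'I_1 -> 'I_m) f :
  \det (mxsub r f A) = A (r 0) (f 0).
Proof. by rewrite det_mx11 mxE. Qed.

Lemma det_mxsub2 m n (A : 'M[K]_(m, n)) (r : 'I_2 -> 'I_m) f :
  \det (mxsub r f A) = minor2 A (r 0) (r 1) (f 0) (f 1).
Proof.
rewrite (expand_det_row _ 0) !big_ord_recl big_ord0 addr0 /cofactor !det_mx11.
rewrite !mxE /= expr0 expr1 mul1r mulN1r mulrN.
have -> : lift 0 0 = 1 :> 'I_2 by exact: val_inj.
by have -> : lift 1 0 = 0 :> 'I_2 by exact: val_inj.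
Qed.

Lemma det_mxsub3 m n (A : 'M[K]_(m, n)) (r : 'I_3 -> 'I_m) f :
  \det (mxsub r f A) = minor3 A (r i1) (r i2) (r i3) (f i1) (f i2) (f i3).
Proof.
rewrite (expand_det_row _ i1) !big_ord_recl big_ord0 addr0 /cofactor.
have cE j : row' i1 (col' j (mxsub r f A)) = mxsub (r \o lift i1) (f \o lift j) A.
  by apply/matrixP => i k; rewrite !mxE.
rewrite !cE !det_mxsub2 !mxE /= expr0 expr1 mul1r mulN1r mulrN.
have -> : lift i1 0 = i2 :> 'I_3 by exact: val_inj.
have -> : lift i1 1 = i3 :> 'I_3 by exact: val_inj.
rewrite -signr_odd mul1r addrA.
have -> : lift ord0 0 = i2 :> 'I_3 by exact: val_inj.
have -> : lift i2 0 = i1 :> 'I_3 by exact: val_inj.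
have -> : lift i2 1 = i3 :> 'I_3 by exact: val_inj.
have -> : lift ord0 (lift ord0 ord0) = i3 :> 'I_3 by exact: val_inj.
have -> : lift i3 0 = i1 :> 'I_3 by exact: val_inj.
have -> : lift i3 1 = i2 :> 'I_3 by exact: val_inj.
have -> : lift ord0 1 = i3 :> 'I_3 by exact: val_inj.
by have -> : ord0 = i1 :> 'I_3 by exact: val_inj.
Qed.

(** Desnanot-Jacobi identity, condensing on the entry [A i a]. *)
Lemma minor3_condense m n (A : 'M[K]_(m, n)) i j k a b c :
  A i a * minor3 A i j k a b c =
  minor2 A i j a b * minor2 A i k a c - minor2 A i j a c * minor2 A i k a b.
Proof. rewrite /minor3 /minor2; ring. Qed.

(** Laplace expansion of [minor3] along the column [a]. *)
Lemma minor3_incidence m n (A : 'M[K]_(m, n)) i j k a b c :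
  A i a * minor2 A j k b c =
  minor3 A i j k a b c + (A j a * minor2 A i k b c - A k a * minor2 A i j b c).
Proof. rewrite /minor3 /minor2; ring. Qed.

End SmallMinors.

Definition lowmx (K : nzRingType) (p q r : K) : 'M[K]_3 :=
  \matrix_(i, j) nth 0 (nth [::] [:: [:: 1; 0; 0]; [:: p; 1; 0]; [:: q; r; 1]] i) j.

Lemma lowmx_unit (K : fieldType) (p q r : K) : lowmx p q r \in unitmx.
Proof.
rewrite unitmxE det_trig; last first.
  by apply/is_trig_mxP; apply: ord3P; apply: ord3P => //= _; rewrite mxE.
by rewrite !big_ord_recl big_ord0 !mxE /= !mul1r unitr1.
Qed.

Section Rank3.
Variable R : realType.
Local Notation K := (puiseux R).
Implicit Types (i j k a b c : 'I_3) (x : R).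

Section Minors.
Variable A : 'M[K]_3.
Hypothesis Au : A \in unitmx.
Local Notation h I := (at_set (entropy_of A) I).

Lemma set1_neq0 i : [set i]%SET != finset.set0 :> {set 'I_3}.
Proof. by apply/set0Pn; exists i; rewrite inE. Qed.

Lemma set2_neq0 i j : [set i; j]%SET != finset.set0 :> {set 'I_3}.
Proof. by apply/set0Pn; exists i; rewrite !inE eqxx. Qed.

Lemma setT_neq0 : [set: 'I_3]%SET != finset.set0.
Proof. by apply/set0Pn; exists i1; rewrite inE. Qed.

Lemma entropy1_le i a : ((h [set i]%SET)%:E <= pval (A i a))%E.
Proof.
rewrite at_entropy_of ?set1_neq0 // -(det_mxsub1 A (fun=> i) (fun=> a)).
by apply: min_val_minor_le (cards1 i) _ _ _ => [j k|j]; rewrite ?inE // !ord1.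
Qed.

Lemma entropy1_attained i : exists a, pval (A i a) = (h [set i]%SET)%:E.
Proof.
have r1 : injective (fun _ : 'I_1 => i) by move=> j k; rewrite !ord1.
have [|f fE] := min_val_minor_attained A (cards1 i) r1; first by move=> j; rewrite inE.
by exists (f 0); rewrite at_entropy_of ?set1_neq0 // fE det_mxsub1.
Qed.

Lemma card_set2 i j : i != j -> #|[set i; j]%SET| = 2%N.
Proof. by move=> ij; rewrite cards2 ij. Qed.

Lemma tnth2_inj i j : i != j -> injective (tnth [tuple i; j]).
Proof. by move=> ij; apply/tuple_uniqP; rewrite /= inE ij. Qed.

Lemma tnth2_in i j l : tnth [tuple i; j] l \in [set i; j]%SET.
Proof. by have := mem_tnth l [tuple i; j]; rewrite !inE. Qed.

Lemma entropy2_le i j a b : i != j ->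
  ((h [set i; j]%SET)%:E <= pval (minor2 A i j a b))%E.
Proof.
move=> ij; rewrite at_entropy_of ?set2_neq0 //.
have := min_val_minor_le A (card_set2 ij) (tnth2_inj ij) (tnth2_in i j)
  (tnth [tuple a; b]).
by rewrite det_mxsub2.
Qed.

Lemma entropy2_attained i j : i != j ->
  exists a b, pval (minor2 A i j a b) = (h [set i; j]%SET)%:E.
Proof.
move=> ij; have [f fE] :=
  min_val_minor_attained A (card_set2 ij) (tnth2_inj ij) (tnth2_in i j).
exists (f 0), (f 1); rewrite at_entropy_of ?set2_neq0 // fE.
by rewrite det_mxsub2.
Qed.

Lemma entropy3_le i j k a b c : uniq [:: i; j; k] ->
  ((h [set: 'I_3]%SET)%:E <= pval (minor3 A i j k a b c))%E.
Proof.
move=> u; rewrite at_entropy_of ?setT_neq0 //.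
have cT : #|[set: 'I_3]%SET| = 3%N by rewrite cardsT card_ord.
have rI : injective (tnth [tuple i; j; k]) by apply/tuple_uniqP.
have := min_val_minor_le A cT rI (fun=> finset.in_setT _) (tnth [tuple a; b; c]).
by rewrite det_mxsub3.
Qed.

Lemma entropy3_eq i j k a b c : uniq [:: i; j; k] -> uniq [:: a; b; c] ->
  pval (minor3 A i j k a b c) = (h [set: 'I_3]%SET)%:E.
Proof.
move=> ur uc; rewrite at_entropy_of ?setT_neq0 //.
have cT : #|[set: 'I_3]%SET| = 3%N by rewrite cardsT card_ord.
have rI : injective (tnth [tuple i; j; k]) by apply/tuple_uniqP.
have fI : injective (tnth [tuple a; b; c]) by apply/tuple_uniqP.
have dE : pval (minor3 A i j k a b c) = pval (\det A).
  by rewrite -(pval_det_mxsub A rI fI) det_mxsub3.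
apply/esym/(min_val_minor_eq cT rI (fun=> finset.in_setT _)) => [f|].
  have [/injectiveP gI|/injectivePn [l [m lm flm]]] := boolP (injectiveb f).
    by rewrite pval_det_mxsub // dE.
  rewrite -det_tr (determinant_alternate lm) ?pval0 ?leey // => n.
  by rewrite !mxE flm.
by exists (tnth [tuple a; b; c]); rewrite det_mxsub3.
Qed.

Lemma entropy_super1 i j : i != j -> h [set i]%SET + h [set j]%SET <= h [set i; j]%SET.
Proof.
move=> ij; have [a [b E]] := entropy2_attained ij; rewrite -lee_fin -E.
apply: pval_geB; first by apply: pval_geM; exact: entropy1_le.
by apply: pval_geM; exact: entropy1_le.
Qed.

Lemma entropy_super2 i j k : uniq [:: i; j; k] ->
  h [set i; j]%SET + h [set i; k]%SET <= h [set i]%SET + h [set: 'I_3]%SET.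
Proof.
move=> u; have /and3P[] := u; rewrite !inE negb_or => /andP[ij ik] _ _.
have [a aE] := entropy1_attained i.
have uc : uniq [:: a; a + i2; a + i3].
  by move: (a); apply: ord3P.
rewrite -lee_fin -(pvalM aE (entropy3_eq u uc)) minor3_condense.
apply: pval_geB; first by apply: pval_geM; exact: entropy2_le.
by apply: pval_geM; exact: entropy2_le.
Qed.

(** The ultrametric inequality applied to the incidence relation between the
    rows [i], [j], [k] and their 2 x 2 minors. If the term of row [i] were
    strictly dominant, it would bound the valuation of the determinant from
    above, and supermodularity would then make the two other terms no larger
    in valuation. *)
Lemma entropy_incidence i j k : uniq [:: i; j; k] ->
  Num.min (h [set j]%SET + h [set i; k]%SET) (h [set k]%SET + h [set i; j]%SET)
    <= h [set i]%SET + h [set j; k]%SET.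
Proof.
move=> u; have /and3P[] := u; rewrite !inE negb_or => /andP[ij ik] jk _.
rewrite leNgt; apply/negP; rewrite lt_min => /andP[hj hk].
have [a aE] := entropy1_attained i; have [b [c mE]] := entropy2_attained jk.
have := pvalM aE mE; rewrite minor3_incidence => E.
have : h [set: 'I_3]%SET <= h [set i]%SET + h [set j; k]%SET.
  rewrite leNgt; apply/negP => hT; suff : (pval (minor3 A i j k a b c +
    (A j a * minor2 A i k b c - A k a * minor2 A i j b c)) >
    (h [set i]%SET + h [set j; k]%SET)%:E)%E by rewrite E ltxx.
  pose x := Num.min (h [set: 'I_3]%SET)
    (Num.min (h [set j]%SET + h [set i; k]%SET) (h [set k]%SET + h [set i; j]%SET)).
  apply: lt_le_trans (_ : x%:E <= _)%E; first by rewrite lte_fin !lt_min hT hj.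
  have xT : x <= h [set: 'I_3]%SET by rewrite ge_min lexx.
  have xj : x <= h [set j]%SET + h [set i; k]%SET by rewrite !ge_min lexx orbT.
  have xk : x <= h [set k]%SET + h [set i; j]%SET by rewrite !ge_min lexx !orbT.
  apply: pval_geD; first by apply: le_trans (entropy3_le _ _ _ u); rewrite lee_fin.
  apply: pval_geB; apply: (@le_trans _ _ (_ + _)%:E); rewrite ?lee_fin;
    [exact: xj| |exact: xk|].
    by apply: pval_geM; [exact: entropy1_le|exact: entropy2_le].
  by apply: pval_geM; [exact: entropy1_le|exact: entropy2_le].
have uj : uniq [:: j; i; k] by rewrite /= !inE negb_or eq_sym ij jk ik.
have uk : uniq [:: k; i; j] by rewrite /= !inE negb_or !(eq_sym k) ij jk ik.
have := entropy_super2 uj; have := entropy_super2 uk; have := entropy_super1 ij.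
have := entropy_super1 ik; have := entropy_super1 jk.
rewrite !(finset.setUC [set j] [set i])%SET !(finset.setUC [set k])%SET.
move: hj hk; lra.
Qed.

End Minors.

End Rank3.

(** * Coordinates on set functions of rank three *)
Section Coordinates.
Variable R : realType.
Local Notation V := (setvec R 3).
Implicit Types (u v : V) (I J : {set 'I_3}).

Lemma set3_eq I J : (i1 \in I) = (i1 \in J) -> (i2 \in I) = (i2 \in J) ->
  (i3 \in I) = (i3 \in J) -> I = J.
Proof. by move=> e1 e2 e3; apply/setP; apply: ord3P. Qed.

Definition coord3 v (b1 b2 b3 : bool) : R :=
  match b1, b2, b3 with
  | false, false, false => 0
  | true, false, false => x1 v
  | false, true, false => x2 v
  | false, false, true => x3 v
  | true, true, false => x12 v
  | true, false, true => x13 v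
  | false, true, true => x23 v
  | true, true, true => x123 v
  end.

Lemma at_set3 v I : at_set v I = coord3 v (i1 \in I) (i2 \in I) (i3 \in I).
Proof.
case e1: (i1 \in I); case e2: (i2 \in I); case e3: (i3 \in I) => /=;
  try (congr at_set; apply: set3_eq; by rewrite ?e1 ?e2 ?e3 !inE).
by rewrite (_ : I = finset.set0) ?at_set0 //; apply: set3_eq; rewrite ?e1 ?e2 ?e3 inE.
Qed.

Lemma setvec3_eq u v : x1 u = x1 v -> x2 u = x2 v -> x3 u = x3 v ->
  x12 u = x12 v -> x13 u = x13 v -> x23 u = x23 v -> x123 u = x123 v -> u = v.
Proof.
move=> *; apply: setvec_eq => I; rewrite !at_set3.
by case: (i1 \in I); case: (i2 \in I); case: (i3 \in I).
Qed.

(** Supermodularity is a local condition: it suffices to test two sets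
    that differ from their intersection by one element each. *)
Lemma supermodular3P v : supermodular_cone v <->
  [/\ x1 v + x2 v <= x12 v, x1 v + x3 v <= x13 v & x2 v + x3 v <= x23 v] /\
  [/\ x12 v + x13 v <= x1 v + x123 v, x12 v + x23 v <= x2 v + x123 v
    & x13 v + x23 v <= x3 v + x123 v].
Proof.
split=> [vS|[[s1 s2 s3] [t1 t2 t3]] I J].
  have S I J := vS I J.
  have {}S I J : coord3 v (i1 \in I) (i2 \in I) (i3 \in I) +
      coord3 v (i1 \in J) (i2 \in J) (i3 \in J) <=
      coord3 v ((i1 \in I) && (i1 \in J)) ((i2 \in I) && (i2 \in J)) ((i3 \in I) && (i3 \in J))
    + coord3 v ((i1 \in I) || (i1 \in J)) ((i2 \in I) || (i2 \in J)) ((i3 \in I) || (i3 \in J)).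
    by have := vS I J; rewrite !at_set3 !finset.in_setI !finset.in_setU.
  have := S [set i1]%SET [set i2]%SET; have := S [set i1]%SET [set i3]%SET.
  have := S [set i2]%SET [set i3]%SET.
  have := S [set i1; i2]%SET [set i1; i3]%SET; have := S [set i1; i2]%SET [set i2; i3]%SET.
  have := S [set i1; i3]%SET [set i2; i3]%SET.
  by rewrite !inE /= !add0r => *; split; split.
rewrite !at_set3 !finset.in_setI !finset.in_setU.
case: (i1 \in I); case: (i2 \in I); case: (i3 \in I); case: (i1 \in J);
  case: (i2 \in J); case: (i3 \in J) => /=; lra.
Qed.

Lemma x1D u v : x1 (u + v) = x1 u + x1 v. Proof. exact: at_setD. Qed.
Lemma x2D u v : x2 (u + v) = x2 u + x2 v. Proof. exact: at_setD. Qed.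
Lemma x3D u v : x3 (u + v) = x3 u + x3 v. Proof. exact: at_setD. Qed.
Lemma x12D u v : x12 (u + v) = x12 u + x12 v. Proof. exact: at_setD. Qed.
Lemma x13D u v : x13 (u + v) = x13 u + x13 v. Proof. exact: at_setD. Qed.
Lemma x23D u v : x23 (u + v) = x23 u + x23 v. Proof. exact: at_setD. Qed.
Lemma x123D u v : x123 (u + v) = x123 u + x123 v. Proof. exact: at_setD. Qed.
Definition xD := (x1D, x2D, x3D, x12D, x13D, x23D, x123D).

Lemma x1Z k v : x1 (k *: v) = k * x1 v. Proof. exact: at_setZ. Qed.
Lemma x2Z k v : x2 (k *: v) = k * x2 v. Proof. exact: at_setZ. Qed.
Lemma x3Z k v : x3 (k *: v) = k * x3 v. Proof. exact: at_setZ. Qed.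
Lemma x12Z k v : x12 (k *: v) = k * x12 v. Proof. exact: at_setZ. Qed.
Lemma x13Z k v : x13 (k *: v) = k * x13 v. Proof. exact: at_setZ. Qed.
Lemma x23Z k v : x23 (k *: v) = k * x23 v. Proof. exact: at_setZ. Qed.
Lemma x123Z k v : x123 (k *: v) = k * x123 v. Proof. exact: at_setZ. Qed.
Definition xZ := (x1Z, x2Z, x3Z, x12Z, x13Z, x23Z, x123Z).

Lemma projW_in v : projW v \in W R. Proof. exact: memv_pi. Qed.

Lemma projW_id v : v \in W R -> projW v = v.
Proof. exact: daddv_pi_id (W_lineality3_direct R). Qed.

Lemma projW_lineality v : v - projW v \in lineality3 R.
Proof.
have vWL : v \in (W R + lineality3 R)%VS by rewrite W_lineality3_full memvf.
rewrite -{1}(daddv_pi_add (W_lineality3_direct R) vWL) addrAC subrr add0r.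
exact: memv_pi.
Qed.

(** A set that is invariant under translation by the lineality space meets [W]
    in its projection. *)
Lemma projW_image (C : set V) :
  (forall u v, C u -> v \in lineality3 R -> C (u + v)) ->
  @projW R @` C = C `&` [set` W R].
Proof.
move=> CL; apply/seteqP; split=> [_ [v Cv <-]|v [Cv vW]]; last first.
  by exists v => //; exact: projW_id.
split; last exact: projW_in.
have -> : projW v = v + - (v - projW v) by rewrite opprB addrC subrK.
by apply: CL => //; rewrite memvN projW_lineality.
Qed.

Lemma projW_sum (C : set V) :
  (forall u v, C u -> v \in lineality3 R -> C (u + v)) ->
  C = minkowski_sum (@projW R @` C) [set` lineality3 R].
Proof.
move=> CL; apply/seteqP; split=> [v Cv|_ [u + [l lL <-]]].
  exists (projW v); first by exists v.
  by exists (v - projW v); [exact: projW_lineality|rewrite addrC subrK].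
by rewrite projW_image // => -[Cu _]; apply: CL.
Qed.

Lemma supermodular_add_lineality u v :
  supermodular_cone u -> v \in lineality3 R -> supermodular_cone (u + v).
Proof.
move=> uS /mem_lineality vM I J; rewrite !at_setD.
by have := uS I J; have := vM I J; lra.
Qed.

Lemma mem_supermodular_proj v : supermodular_proj v <-> v \in W R /\
  [/\ x2 v <= 0, x3 v <= x13 v & x13 v <= 0] /\
  [/\ x2 v + x3 v <= x23 v, x23 v <= x2 v & x13 v + x23 v <= x3 v].
Proof.
rewrite /supermodular_proj projW_image; last exact: supermodular_add_lineality.
split=> [[/supermodular3P[[s1 s2 s3] [t1 t2 t3]] vW]|[vW [[s1 s2 s3] [t1 t2 t3]]]].
  have /mem_W[v1 v12 v123] := vW; split=> //.
  by move: s1 s2 s3 t1 t2 t3; rewrite v1 v12 v123 => *; do !split; lra.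
split=> //; have /mem_W[v1 v12 v123] := vW; apply/supermodular3P.
by rewrite v1 v12 v123; do !split; lra.
Qed.

(** * The entropy image *)
Lemma entropy_image_super v : entropy_image v -> supermodular_cone v.
Proof.
case/entropy_imageP => A Au ->; apply/supermodular3P; split; split.
- exact: entropy_super1.
- exact: entropy_super1.
- exact: entropy_super1.
- exact: (@entropy_super2 _ A Au i1 i2 i3).
- have := @entropy_super2 _ A Au i2 i1 i3 isT.
  by rewrite (finset.setUC [set i2] [set i1])%SET.
- have := @entropy_super2 _ A Au i3 i1 i2 isT.
  by rewrite !(finset.setUC [set i3])%SET.
Qed.

Lemma entropy_image_incidence v : entropy_image v ->
  [/\ Num.min (x2 v + x13 v) (x3 v + x12 v) <= x1 v + x23 v,
      Num.min (x1 v + x23 v) (x3 v + x12 v) <= x2 v + x13 v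
    & Num.min (x1 v + x23 v) (x2 v + x13 v) <= x3 v + x12 v].
Proof.
case/entropy_imageP => A Au ->; split.
- exact: (@entropy_incidence _ A Au i1 i2 i3 isT).
- have := @entropy_incidence _ A Au i2 i1 i3 isT.
  by rewrite (finset.setUC [set i2] [set i1])%SET.
- have := @entropy_incidence _ A Au i3 i1 i2 isT.
  by rewrite !(finset.setUC [set i3])%SET.
Qed.

(** On [W] the minimum of [z], [w + y] and [x] is attained twice; the pair that
    realizes it selects the cone. *)
Lemma entropy_proj_sub : @entropy_proj R `<=` @sigma1 R `|` @sigma2 R `|` @sigma3 R.
Proof.
rewrite /entropy_proj projW_image; last exact: entropy_image_lineality.
move=> v [vE vW]; have /mem_W[v1 v12 v123] := vW.
have [] := entropy_image_incidence vE.
have /supermodular3P := entropy_image_super vE.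
rewrite v1 v12 v123 add0r addr0 !ge_min => -[[s1 s2 s3] [t1 t2 t3]].
by case/orP => p1; case/orP => p2; case/orP => p3;
  first [left; left; split=> //; split; lra | left; right; split=> //; split; lra
        |right; split=> //; split; lra].
Qed.

Lemma entropy1_eq (A : 'M[puiseux R]_3) i x : A \in unitmx ->
  (forall a, (x%:E <= pval (A i a))%E) ->
  (exists a, (pval (A i a) <= x%:E)%E) -> at_set (entropy_of A) [set i]%SET = x.
Proof.
move=> Au xle [a ax]; apply/le_anti; rewrite -!lee_fin.
rewrite (le_trans (entropy1_le Au i a) ax) /=.
by have [b <-] := entropy1_attained Au i; exact: xle.
Qed.

Lemma entropy2_eq (A : 'M[puiseux R]_3) i j x : A \in unitmx -> i != j ->
  (forall a b, (x%:E <= pval (minor2 A i j a b))%E) ->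
  (exists a b, (pval (minor2 A i j a b) <= x%:E)%E) ->
  at_set (entropy_of A) [set i; j]%SET = x.
Proof.
move=> Au ij xle [a [b ax]]; apply/le_anti; rewrite -!lee_fin.
rewrite (le_trans (entropy2_le Au a b ij) ax) /=.
by have [c [d <-]] := entropy2_attained Au ij; exact: xle.
Qed.

(** The matrix with rows [1 0 0], [t^w 1 0] and [q t^y 1] has entropy vector
    in [W]; its entries and minors give [w] and [y] at once, and [q] is left
    free to prescribe [x] and [z]. *)
Lemma entropy_lowmx v (q : puiseux R) : v \in W R ->
  x2 v <= 0 -> x13 v <= 0 -> x3 v <= x13 v -> x23 v <= x2 v ->
  pval q = (x3 v)%:E -> pval (tpow (x2 v) * tpow (x13 v) - q) = (x23 v)%:E ->
  entropy_image v.
Proof.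
move=> /mem_W[v1 v12 v123] w0 y0 xy zw qE mE; apply/entropy_imageP.
pose A := lowmx (tpow (x2 v)) q (tpow (x13 v)).
have Au : A \in unitmx by exact: lowmx_unit.
have pE := pval_tpow (x2 v); have rE := pval_tpow (x13 v).
have oneE : pval (1 : puiseux R) = 0%:E by rewrite -tpow0 pval_tpow.
exists A => //; apply/esym/setvec3_eq.
- rewrite v1; apply: entropy1_eq => //.
    by apply: ord3P; rewrite mxE /= ?oneE ?pval0 ?leey.
  by exists i1; rewrite mxE /= oneE.
- apply: entropy1_eq => //.
    by apply: ord3P; rewrite mxE /= ?oneE ?pval0 ?leey ?pE ?lee_fin.
  by exists i1; rewrite mxE /= pE.
- apply: entropy1_eq => //.
    by apply: ord3P; rewrite mxE /= ?oneE ?rE ?qE ?lee_fin // (le_trans xy).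
  by exists i1; rewrite mxE /= qE.
- rewrite v12; apply: entropy2_eq => //.
    by apply: ord3P; apply: ord3P; rewrite /minor2 !mxE /= ?(mulr0, mul0r, mulr1,
      mul1r, subrr, subr0, sub0r, pvalN, pval0, oneE) ?leey.
  by exists i1, i2; rewrite /minor2 !mxE /= mul0r subr0 mul1r oneE.
- apply: entropy2_eq => //.
    by apply: ord3P; apply: ord3P; rewrite /minor2 !mxE /= ?(mulr0, mul0r, mulr1,
      mul1r, subrr, subr0, sub0r, pvalN, pval0, oneE, rE) ?leey ?lee_fin.
  by exists i1, i2; rewrite /minor2 !mxE /= mul0r subr0 mul1r rE.
- apply: entropy2_eq => //.
    apply: ord3P; apply: ord3P; rewrite /minor2 !mxE /= ?(mulr0, mul0r, mulr1,
      mul1r, subrr, subr0, sub0r, pvalN, pval0, oneE, rE, pE) ?leey ?lee_fin ?mE //.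
    + by rewrite -opprB pvalN mE.
    + by rewrite (le_trans zw).
    + by rewrite (le_trans zw).
  by exists i1, i2; rewrite /minor2 !mxE /= mul1r mE.
- rewrite v123; apply: EFin_inj.
  rewrite -(@entropy3_eq _ A Au i1 i2 i3 i1 i2 i3 isT isT) -oneE; congr (pval _).
  by rewrite /minor3 /minor2 !mxE /= !(mulr0, mul0r, mulr1, mul1r, subr0, addr0).
Qed.

Lemma entropy_proj_sup : @sigma1 R `|` @sigma2 R `|` @sigma3 R `<=` @entropy_proj R.
Proof.
rewrite /entropy_proj projW_image; last exact: entropy_image_lineality.
move=> v.
(* The sign of [q] lets the two monomials of [t^(w + y) - q] add up instead of
   cancelling; on the third cone, where [x = w + y], cancelling the leading
   term of [q] is what leaves the valuation [z]. *)
have tE a : pval (- tpow a : puiseux R) = a%:E by rewrite pvalN pval_tpow.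
case=> [[[vW /= [w0 xwy y0 zx]]|[vW /= [w0 xy y0 ywx zyw]]]|[vW /= [w0 y0 xyw zw xz]]];
  split=> //.
- apply: (@entropy_lowmx _ (- tpow (x3 v))); rewrite ?tE //; [lra|lra|].
  by rewrite opprK -tpowD [tpow _ + _]addrC pval_tpowD // zx.
- apply: (@entropy_lowmx _ (- tpow (x3 v))); rewrite ?tE //; [lra|].
  by rewrite opprK -tpowD pval_tpowD; [congr (_%:E); lra|lra].
- apply: (@entropy_lowmx _ (tpow (x2 v + x13 v) + tpow (x23 v))) => //; [lra| |].
    by rewrite pval_tpowD; [congr (_%:E); lra|lra].
  by rewrite -tpowD opprD addrA subrr add0r tE.
Qed.

End Coordinates.

(** * Cones spanned by parts of a free family *)
Section SimplicialCones.
Variables (R : realType) (V : vectType R).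
Implicit Types (C D F : set V) (U : {vspace V}).

Lemma pointedP C : C 0 -> (forall v, C v -> C (- v) -> v = 0) -> pointed C.
Proof.
move=> C0 CN; split=> [v /=|U UC]; first by rewrite memv0 => /eqP ->.
apply/subvP => v vU; rewrite memv0; apply/eqP/CN; first exact: UC.
by apply: UC; rewrite /= memvN.
Qed.

Lemma pointed_sub C D : C `<=` D -> C 0 -> pointed D -> pointed C.
Proof.
move=> CD C0 [_ Dp]; split=> [v /=|U UC]; first by rewrite memv0 => /eqP ->.
by apply: Dp; exact: subset_trans CD.
Qed.

Lemma polyhedral_setI C D : polyhedral_cone C -> polyhedral_cone D ->
  polyhedral_cone (C `&` D).
Proof.
move=> [s ->] [t ->]; exists (s ++ t); apply/seteqP; split=> v /=.
  by move=> [sv tv] l; rewrite mem_cat => /orP[/sv|/tv].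
by move=> stv; split=> l ls; apply: stv; rewrite mem_cat ls ?orbT.
Qed.

Lemma polyhedral_halfspace (f : 'Hom(V, R^o)) :
  polyhedral_cone [set v | 0 <= (f v : R)].
Proof.
exists [:: f]; apply/seteqP; split=> v /= fv; first by move=> l; rewrite inE => /eqP ->.
by apply: fv; rewrite inE.
Qed.

Lemma polyhedral_hyperplane (f : 'Hom(V, R^o)) :
  polyhedral_cone [set v | (f v : R) = 0].
Proof.
have -> : [set v | (f v : R) = 0] = [set v | 0 <= (f v : R)] `&` [set v | 0 <= ((- f)%VF v : R)].
  apply/seteqP; split=> v /=; rewrite opp_lfunE oppr_ge0.
    by move=> ->; rewrite lexx.
  by move=> [f0 f1]; apply/le_anti; rewrite f0 f1.
by apply: polyhedral_setI; exact: polyhedral_halfspace.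
Qed.

(** A face is cut out by one more equation. *)
Lemma polyhedral_face C F : polyhedral_cone C -> is_face C F -> polyhedral_cone F.
Proof.
move=> pC [l [_ ->]]; apply: polyhedral_setI => //; exact: polyhedral_hyperplane.
Qed.

Lemma is_face_refl C : is_face C C.
Proof.
exists 0%VF; split=> [v _|]; first by rewrite zero_lfunE.
by apply/seteqP; split=> [v Cv|v []//]; split; rewrite //= zero_lfunE.
Qed.

Lemma cone_dim_le C D : C `<=` D -> (cone_dim C <= cone_dim D)%N.
Proof.
move=> CD; apply: dimvS; have [_] := linear_spanP C; apply.
by have [DS _] := linear_spanP D; exact: subset_trans DS.
Qed.

Lemma cone_dim_free C (X : seq V) : free X -> [set` X] `<=` C ->
  C `<=` [set` <<X>>%VS] -> cone_dim C = size X.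
Proof.
move=> fX XC CX; rewrite -(eqP fX); congr (\dim _); apply/eqP.
have [CS Cmin] := linear_spanP C.
rewrite eqEsubv (Cmin _ CX) /=; apply/span_subvP => x xX.
by apply: CS; exact: XC.
Qed.

Section Family.
Variables (n : nat) (X : n.-tuple V).
Implicit Types S T : {set 'I_n}.

Definition conical S : set V :=
  [set \sum_(i in S) c i *: X`_i | c in [set c : 'I_n -> R | forall i, 0 <= c i]].

(** A functional that is nonnegative on the generators vanishes on a conical
    combination exactly when it vanishes on each generator that occurs in it. *)
Lemma face_conical S F : is_face (conical S) F ->
  exists2 T : {set 'I_n}, T \subset S & F = conical T.
Proof.
move=> [l [l0 ->]].
have lX i : i \in S -> 0 <= (l X`_i : R).
  move=> iS; apply: l0; exists (fun j => (j == i)%:R) => [j|]; first exact: ler0n.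
  rewrite (bigD1 i) //= eqxx scale1r big1 ?addr0 // => j /andP[_ /negbTE ->].
  by rewrite scale0r.
exists [set i in S | (l X`_i : R) == 0]%SET.
  by apply/fintype.subsetP => i; rewrite inE => /andP[].
apply/seteqP; split=> [_ [[c c0 <-] /=]|_ [c c0 <-]].
  rewrite linear_sum /= => lc0; exists c => //.
  rewrite [RHS](big_setID [set i in S | (l X`_i : R) == 0]%SET) /=.
  rewrite [X in _ = _ + X]big1 ?addr0 => [|i].
    by apply: eq_bigl => i; rewrite !inE; case: (i \in S).
  rewrite !inE => /andP[]; case iS: (i \in S) => //= li _.
  have lE : \sum_(j in S) c j * (l X`_j : R) = 0.
    by rewrite -[RHS]lc0; apply: eq_bigr => j _; rewrite linearZ.
  have /eqP := psumr_eq0P (fun j jS => mulr_ge0 (c0 j) (lX j jS)) lE iS.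
  by rewrite mulf_eq0 (negbTE li) orbF => /eqP ->; rewrite scale0r.
split.
  exists (fun i => if i \in [set i in S | (l X`_i : R) == 0]%SET then c i else 0).
    by move=> i /=; case: ifP.
  rewrite (big_setID [set i in S | (l X`_i : R) == 0]%SET) /=.
  rewrite [X in _ + X]big1 ?addr0 => [|i].
    rewrite (_ : S :&: _ = [set i in S | (l X`_i : R) == 0])%SET.
      by apply: eq_bigr => i ->.
    by apply/setP => i; rewrite !inE; case: (i \in S).
  by rewrite inE => /andP[/negbTE -> _]; rewrite scale0r.
rewrite /= linear_sum big1 //= => i; rewrite inE => /andP[_ /eqP li].
by rewrite linearZ /= li scaler0.
Qed.

Hypothesis fX : free X.

Lemma coord_conical S c j :
  coord X j (\sum_(i in S) c i *: X`_i) = if j \in S then c j else 0.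
Proof.
rewrite big_mkcond (eq_bigr (fun i => (if i \in S then c i else 0) *: X`_i)) /=.
  exact: coord_sum_free.
by move=> i _; case: ifP; rewrite ?scale0r.
Qed.

Lemma conicalP S v : conical S v <-> v \in <<X>>%VS /\
  forall i, 0 <= coord X i v /\ (i \notin S -> coord X i v = 0).
Proof.
split=> [[c c0 <-]|[vX vS]].
  split=> [|i]; last by rewrite coord_conical; case: (i \in S).
  by apply: rpred_sum => i _; apply/rpredZ/memv_span/mem_nth; rewrite size_tuple.
exists (coord X ^~ v); first by move=> i; have [] := vS i.
rewrite [RHS](coord_span vX) [RHS](bigID (mem S)) /= [X in _ = _ + X]big1 ?addr0 //.
by move=> i iS; have [_ ->] := vS i; rewrite ?scale0r.
Qed.

Lemma conical_setI S T : conical S `&` conical T = conical (S :&: T)%SET.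
Proof.
apply/seteqP; split=> v.
  move=> [/conicalP[vX vS] /conicalP[_ vT]]; apply/conicalP; split=> // i.
  have [v0 vSi] := vS i; have [_ vTi] := vT i.
  by split=> //; rewrite !inE negb_and => /orP[/vSi|/vTi].
move=> /conicalP[vX vI]; split; apply/conicalP; split=> // i;
  have [v0 vIi] := vI i; split=> // iN; apply: vIi;
  by rewrite inE negb_and iN ?orbT.
Qed.

(** The sum of the coordinates outside [T] is a supporting functional. *)
Lemma conical_face S T : T \subset S -> is_face (conical S) (conical T).
Proof.
move=> TS.
pose l : 'Hom(V, R^o) := \sum_(i in S :\: T) linfun (coord X i : V -> R^o).
have lE v : l v = \sum_(i in S :\: T) coord X i v.
  by rewrite sum_lfunE; apply: eq_bigr => i _; rewrite lfunE.
exists l; split=> [v /conicalP[_ vS]|].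
  by rewrite lE; apply: sumr_ge0 => i _; have [] := vS i.
apply/seteqP; split=> v.
  move=> vT; have [vX vTi] := (conicalP _ _).1 vT; split.
    apply/conicalP; split=> // i; have [v0 viT] := vTi i; split=> // iS.
    by apply: viT; apply: contra iS; exact: (fintype.subsetP TS).
  by rewrite /= lE big1 // => i; rewrite inE => /andP[iT _]; have [_ ->] := vTi i.
move=> [/conicalP[vX vS] /=]; rewrite lE => l0; apply/conicalP; split=> // i.
have [v0 viS] := vS i; split=> // iT.
have [iS|/viS//] := boolP (i \in S).
apply: (psumr_eq0P _ l0); last by rewrite inE iT.
by move=> j _; have [] := vS j.
Qed.

End Family.

Definition jointly_simplicial C D := exists n (X : n.-tuple V) (S T : {set 'I_n}),
  [/\ free X, C = conical X S & D = conical X T].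

Lemma jointly_simplicial_sym C D : jointly_simplicial C D -> jointly_simplicial D C.
Proof. by move=> [n [X [S [T [fX CE DE]]]]]; exists n, X, T, S. Qed.

Lemma jointly_simplicial_refl C D : jointly_simplicial C D -> jointly_simplicial C C.
Proof. by move=> [n [X [S [T [fX CE DE]]]]]; exists n, X, S, S. Qed.

(** Two members of the fan are faces of two of the given cones, hence spanned by
    parts of one free family: everything reduces to the Boolean algebra of
    these parts. *)
Lemma simplicial_fan (I : finType) (i0 : I) (sigma : I -> set V) :
  (forall i, polyhedral_cone (sigma i)) ->
  (forall i j, jointly_simplicial (sigma i) (sigma j)) ->
  polyhedral_fan [set F | exists i, is_face (sigma i) F].
Proof.
move=> sP sX; split; first split.
- have -> : [set F | exists i, is_face (sigma i) F] =
      \bigcup_(i in [set: I]) [set F | is_face (sigma i) F].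
    by apply/seteqP; split=> [F [i iF]|F [i _ iF]]; exists i.
  apply: bigcup_finite => [|i _]; first exact: finite_finset.
  have [n [X [S [_ [_ -> _]]]]] := sX i i.
  apply: (@sub_finite_set _ _ (conical X @` [set: {set 'I_n}])).
    by move=> F /face_conical[T _ ->]; exists T.
  by apply: finite_image; exact: finite_finset.
- by exists (sigma i0), i0; exact: is_face_refl.
- by move=> C [i]; apply: polyhedral_face.
- move=> C F [i iC] CF; exists i; have [n [X [S [_ [fX sE _]]]]] := sX i i.
  move: iC CF; rewrite sE => /face_conical[T TS ->] /face_conical[T' T'T ->].
  by apply: conical_face => //; exact: fintype.subset_trans TS.
- move=> C D [i iC] [j jD]; have [n [X [S [T [fX sE tE]]]]] := sX i j.
  move: iC jD; rewrite sE tE => /face_conical[S' _ ->] /face_conical[T' _ ->].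
  by rewrite conical_setI //; split; apply: conical_face; rewrite ?subsetIl ?subsetIr.
Qed.

End SimplicialCones.

(** * The three cones *)
Section Fan.
Variable R : realType.
Local Notation V := (setvec R 3).
Implicit Types (u v a b c d : V) (w x y z : R).

Definition coordW w x y z (I : {set 'I_3}) : R :=
  match i1 \in I, i2 \in I, i3 \in I with
  | false, true, false => w
  | false, false, true => x
  | true, false, true => y
  | false, true, true => z
  | _, _, _ => 0
  end.

Definition vecW w x y z : V := [ffun I : nonempty_set 3 => coordW w x y z (val I)].

Lemma at_vecW w x y z I : at_set (vecW w x y z) I = coordW w x y z I.
Proof.
rewrite /at_set; case: insubP => [J _ <-|/negPn/eqP ->] /=; first by rewrite ffunE.
by rewrite /coordW !inE.
Qed.

Lemma x1_vecW w x y z : x1 (vecW w x y z) = 0. Proof. by rewrite /x1 at_vecW /coordW !inE. Qed.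
Lemma x2_vecW w x y z : x2 (vecW w x y z) = w. Proof. by rewrite /x2 at_vecW /coordW !inE. Qed.
Lemma x3_vecW w x y z : x3 (vecW w x y z) = x. Proof. by rewrite /x3 at_vecW /coordW !inE. Qed.
Lemma x12_vecW w x y z : x12 (vecW w x y z) = 0. Proof. by rewrite /x12 at_vecW /coordW !inE. Qed.
Lemma x13_vecW w x y z : x13 (vecW w x y z) = y. Proof. by rewrite /x13 at_vecW /coordW !inE. Qed.
Lemma x23_vecW w x y z : x23 (vecW w x y z) = z. Proof. by rewrite /x23 at_vecW /coordW !inE. Qed.
Lemma x123_vecW w x y z : x123 (vecW w x y z) = 0. Proof. by rewrite /x123 at_vecW /coordW !inE. Qed.
Definition xvecW :=
  (x1_vecW, x2_vecW, x3_vecW, x12_vecW, x13_vecW, x23_vecW, x123_vecW).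

(** The vertices of a triangular bipyramid: the poles, shared by the three
    cones, and the equator. *)
Definition pole1 := vecW (-1) (-1) 0 (-1).
Definition pole2 := vecW 0 (-1) (-1) (-1).
Definition equator1 := vecW 0 (-1) 0 (-1).
Definition equator2 := vecW (-1) 0 0 (-1).
Definition equator3 := vecW 0 (-1) (-1) 0.

(** Up to scaling, [pole1 + pole2 = equator1 + equator2 + equator3] is the only linear
    relation between the rays. *)
Lemma rays_relation (p q r s t : R) :
  p *: pole1 + q *: pole2 + r *: equator1 + s *: equator2 + t *: equator3 = 0 ->
  [/\ q = p, r = - p, s = - p & t = - p].
Proof.
move=> E; have := congr1 (@x2 R) E; have := congr1 (@x3 R) E.
have := congr1 (@x13 R) E; have := congr1 (@x23 R) E.
rewrite !xD !xZ !xvecW /x2 /x3 /x13 /x23 !at_set_vec0 => *.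
by split; lra.
Qed.

Lemma free4P a b c d : (forall p q r s : R,
    p *: a + q *: b + r *: c + s *: d = 0 -> [/\ p = 0, q = 0, r = 0 & s = 0]) ->
  free [:: a; b; c; d].
Proof.
move=> H; have /freeP : forall k : 'I_4 -> R,
  \sum_(i < 4) k i *: [tuple a; b; c; d]`_i = 0 -> forall i, k i = 0; last by [].
move=> k.
rewrite !big_ord_recl big_ord0 addr0 /= !addrA => /H[k0 k1 k2 k3].
by move=> [[|[|[|[|i]]]] lt] //;
  [rewrite -[RHS]k0|rewrite -[RHS]k1|rewrite -[RHS]k2|rewrite -[RHS]k3];
  congr k; apply: val_inj.
Qed.

Lemma free12 : free [:: pole1; pole2; equator1; equator2].
Proof.
apply: free4P => p q r s E; have := @rays_relation p q r s 0.
by rewrite scale0r addr0 => /(_ E)[*]; split; lra.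
Qed.

Lemma free13 : free [:: pole1; pole2; equator1; equator3].
Proof.
apply: free4P => p q r s E; have := @rays_relation p q r 0 s.
by rewrite scale0r addr0 => /(_ E)[*]; split; lra.
Qed.

Lemma free23 : free [:: pole1; pole2; equator2; equator3].
Proof.
apply: free4P => p q r s E; have := @rays_relation p q 0 r s.
by rewrite scale0r addr0 => /(_ E)[*]; split; lra.
Qed.

Definition cone3 a b c : set V := [set v | exists p q r : R,
  [/\ 0 <= p, 0 <= q & 0 <= r] /\ v = p *: a + q *: b + r *: c].

Lemma cone3_simplicial a b c d : free [:: a; b; c; d] ->
  jointly_simplicial (cone3 a b c) (cone3 a b d).
Proof.
move=> fX; exists 4, [tuple a; b; c; d], [set i : 'I_4 | i != 3 :> nat]%SET,
  [set i : 'I_4 | i != 2 :> nat]%SET.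
split=> //; apply/seteqP; split=> v.
- move=> [p [q [r [[p0 q0 r0] ->]]]]; exists (fun i => [:: p; q; r; 0]`_i).
    by move=> [[|[|[|[|i]]]] lt] /=.
  by rewrite big_mkcond !big_ord_recl big_ord0 !inE /= !addr0 !addrA.
- move=> [k k0 <-]; exists (k 0), (k (lift ord0 ord0)), (k (lift ord0 (lift ord0 ord0))).
  by rewrite big_mkcond !big_ord_recl big_ord0 !inE /= !addr0 !addrA.
- move=> [p [q [r [[p0 q0 r0] ->]]]]; exists (fun i => [:: p; q; 0; r]`_i).
    by move=> [[|[|[|[|i]]]] lt] /=.
  by rewrite big_mkcond !big_ord_recl big_ord0 !inE /= add0r !addr0 !addrA.
- move=> [k k0 <-]; exists (k 0), (k (lift ord0 ord0)),
    (k (lift ord0 (lift ord0 (lift ord0 ord0)))).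
  by rewrite big_mkcond !big_ord_recl big_ord0 !inE /= add0r !addr0 !addrA.
Qed.

Lemma cone3_dim a b c : free [:: a; b; c] -> cone_dim (cone3 a b c) = 3%N.
Proof.
move=> f3; rewrite (cone_dim_free f3) // => v.
  rewrite /= !inE => /or3P[] /eqP ->.
  - by exists 1, 0, 0; rewrite scale1r !scale0r !addr0.
  - by exists 0, 1, 0; rewrite scale1r !scale0r add0r addr0.
  - by exists 0, 0, 1; rewrite scale1r !scale0r !add0r.
move=> [p [q [r [_ ->]]]] /=.
by rewrite !rpredD // rpredZ // memv_span // !inE eqxx ?orbT.
Qed.

Lemma sigma1E : @sigma1 R = cone3 pole1 pole2 equator1.
Proof.
apply/seteqP; split=> [v [/mem_W[v1 v12 v123] /= [w0 xwy y0 zx]]|v].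
  exists (- x2 v), (- x13 v), (x2 v + x13 v - x3 v); split; first by split; lra.
  by apply: setvec3_eq; rewrite !xD !xZ !xvecW; lra.
move=> [p [q [r [[p0 q0 r0] ->]]]]; split.
  by apply/mem_W; rewrite !xD !xZ !xvecW; split; lra.
by rewrite !xD !xZ !xvecW /=; split; lra.
Qed.

Lemma sigma2E : @sigma2 R = cone3 pole1 pole2 equator2.
Proof.
apply/seteqP; split=> [v [/mem_W[v1 v12 v123] /= [w0 xy y0 ywx zyw]]|v].
  exists (x13 v - x3 v), (- x13 v), (x3 v - x13 v - x2 v); split; first by split; lra.
  by apply: setvec3_eq; rewrite !xD !xZ !xvecW; lra.
move=> [p [q [r [[p0 q0 r0] ->]]]]; split.
  by apply/mem_W; rewrite !xD !xZ !xvecW; split; lra.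
by rewrite !xD !xZ !xvecW /=; split; lra.
Qed.

Lemma sigma3E : @sigma3 R = cone3 pole1 pole2 equator3.
Proof.
apply/seteqP; split=> [v [/mem_W[v1 v12 v123] /= [w0 y0 xyw zw xz]]|v].
  exists (- x2 v), (x2 v - x23 v), (x23 v - x13 v - x2 v); split; first by split; lra.
  by apply: setvec3_eq; rewrite !xD !xZ !xvecW; lra.
move=> [p [q [r [[p0 q0 r0] ->]]]]; split.
  by apply/mem_W; rewrite !xD !xZ !xvecW; split; lra.
by rewrite !xD !xZ !xvecW /=; split; lra.
Qed.

(** Named so as to carry the structure of a linear form. *)
Definition at_fun (I : {set 'I_3}) v : R^o := at_set v I.
HB.instance Definition _ I :=
  GRing.isLinear.Build R V R^o _ (at_fun I) (@at_set_linear R 3 I).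

(** Each quadruple [(p, q, r, s)] stands for the inequality
    [0 <= p w + q x + r y + s z]. *)
Lemma polyhedral_system (s : seq (R * R * R * R)) : polyhedral_cone
  [set v | v \in W R /\ all (fun k => 0 <= k.1.1.1 * x2 v + k.1.1.2 * x3 v +
    k.1.2 * x13 v + k.2 * x23 v) s].
Proof.
elim: s => [|k s IHs].
  have -> : [set v | v \in W R /\ all (fun k => 0 <= k.1.1.1 * x2 v + k.1.1.2 * x3 v +
      k.1.2 * x13 v + k.2 * x23 v) [::]] =
    [set v | (linfun (at_fun [set i1]%SET) v : R) = 0] `&`
    [set v | (linfun (at_fun [set i1; i2]%SET) v : R) = 0] `&`
    [set v | (linfun (at_fun [set: 'I_3]%SET) v : R) = 0].
    apply/seteqP; split=> v /=; rewrite !lfunE /=.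
      by move=> [/mem_W[v1 v12 v123] _].
    by move=> [[v1 v12] v123]; split=> //; apply/mem_W.
  by do !apply: polyhedral_setI; exact: polyhedral_hyperplane.
pose f : 'Hom(V, R^o) := (k.1.1.1 *: linfun (at_fun [set i2]%SET) +
  k.1.1.2 *: linfun (at_fun [set i3]%SET) + k.1.2 *: linfun (at_fun [set i1; i3]%SET) +
  k.2 *: linfun (at_fun [set i2; i3]%SET))%VF.
have := polyhedral_setI (polyhedral_halfspace f) IHs; congr polyhedral_cone.
apply/seteqP; split=> v /=; rewrite !add_lfunE !scale_lfunE !lfunE /=.
  by move=> [f0 [vW vs]]; split=> //; apply/andP.
by move=> [vW /andP[f0 vs]].
Qed.

Lemma polyhedral_sigma1 : polyhedral_cone (@sigma1 R).
Proof.
have := polyhedral_system [:: (-1, 0, 0, 0); (1, -1, 1, 0); (0, 0, -1, 0);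
  (0, 1, 0, -1); (0, -1, 0, 1)]; congr polyhedral_cone.
apply/seteqP; split=> v [vW /=].
  by case/and5P => *; split=> //; split; lra.
by move=> [*]; split=> //=; apply/and5P; split; lra.
Qed.

Lemma polyhedral_sigma2 : polyhedral_cone (@sigma2 R).
Proof.
have := polyhedral_system [:: (-1, 0, 0, 0); (0, -1, 1, 0); (0, 0, -1, 0);
  (-1, 1, -1, 0); (1, 0, 1, -1); (-1, 0, -1, 1)]; congr polyhedral_cone.
apply/seteqP; split=> v [vW /=].
  by case/and5P => ? ? ? ? /and3P[*]; split=> //; split; lra.
by move=> [*]; split=> //=; apply/and5P; split; try lra; apply/and3P; split; lra.
Qed.

Lemma polyhedral_sigma3 : polyhedral_cone (@sigma3 R).
Proof.
have := polyhedral_system [:: (-1, 0, 0, 0); (0, 0, -1, 0); (1, -1, 1, 0);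
  (-1, 1, -1, 0); (1, 0, 0, -1); (0, -1, 0, 1)]; congr polyhedral_cone.
apply/seteqP; split=> v [vW /=].
  by case/and5P => ? ? ? ? /and3P[*]; split=> //; split; lra.
by move=> [*]; split=> //=; apply/and5P; split; try lra; apply/and3P; split; lra.
Qed.

Lemma polyhedral_supermodular_proj : polyhedral_cone (@supermodular_proj R).
Proof.
have := polyhedral_system [:: (-1, 0, 0, 0); (0, -1, 1, 0); (0, 0, -1, 0);
  (-1, -1, 0, 1); (1, 0, 0, -1); (0, 1, -1, -1)]; congr polyhedral_cone.
apply/seteqP; split=> v.
  move=> [vW /= /and5P[? ? ? ? /and3P[*]]]; apply/mem_supermodular_proj.
  by split=> //; split; split; lra.
move=> /mem_supermodular_proj[vW [[? ? ?] [? ? ?]]]; split=> //=.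
by apply/and5P; split; try lra; apply/and3P; split; lra.
Qed.

Lemma pointed_supermodular_proj : pointed (@supermodular_proj R).
Proof.
apply: pointedP.
  apply/mem_supermodular_proj; rewrite mem0v /x2 /x3 /x13 /x23 !at_set_vec0.
  by do !split; lra.
move=> v /mem_supermodular_proj[/mem_W[v1 v12 v123] [[? ? ?] [? ? ?]]].
move=> /mem_supermodular_proj[_]; rewrite -scaleN1r !xZ => -[[? ? ?] [? ? ?]].
by apply: setvec3_eq; rewrite [RHS]at_set_vec0; lra.
Qed.

Lemma supermodular_proj_dim : cone_dim (@supermodular_proj R) = 4%N.
Proof.
rewrite (cone_dim_free free12) // => v.
  have inP w x y z : [/\ w <= 0, x <= y & y <= 0] -> [/\ w + x <= z, z <= w & y + z <= x] ->
      supermodular_proj (vecW w x y z).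
    move=> *; apply/mem_supermodular_proj; rewrite !xvecW; split=> //.
    by apply/mem_W; rewrite !xvecW.
  by rewrite /= !inE => /or4P[] /eqP ->; apply: inP; split; lra.
move=> /mem_supermodular_proj[/mem_W[v1 v12 v123] _].
have -> : v = (x23 v - x2 v - x3 v) *: pole1 + (- x13 v) *: pole2 +
    (x2 v + x13 v - x23 v) *: equator1 + (x3 v - x23 v) *: equator2.
  by apply: setvec3_eq; rewrite !xD !xZ !xvecW; lra.
by rewrite /= !rpredD // rpredZ // memv_span // !inE eqxx ?orbT.
Qed.

Lemma entropy_fanE : @entropy_fan R =
  [set F | exists i : 'I_3, is_face (nth set0 [:: @sigma1 R; @sigma2 R; @sigma3 R] i) F].
Proof.
apply/seteqP; split=> F; first by case=> FF; [exists i1|exists i2|exists i3].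
by case; apply: ord3P => /= FF; [constructor 1|constructor 2|constructor 3].
Qed.

Lemma entropy_fan_polyhedral : polyhedral_fan (@entropy_fan R).
Proof.
rewrite entropy_fanE; apply: (simplicial_fan i1).
  apply: ord3P; [exact: polyhedral_sigma1|exact: polyhedral_sigma2|exact: polyhedral_sigma3].
have J12 := cone3_simplicial free12; have J13 := cone3_simplicial free13.
have J23 := cone3_simplicial free23.
have J21 := jointly_simplicial_sym J12; have J31 := jointly_simplicial_sym J13.
have J32 := jointly_simplicial_sym J23; have J11 := jointly_simplicial_refl J12.
have J22 := jointly_simplicial_refl J21; have J33 := jointly_simplicial_refl J31.
by apply: ord3P; apply: ord3P => /=; rewrite ?sigma1E ?sigma2E ?sigma3E.
Qed.

Lemma sigma_dim C : [\/ C = @sigma1 R, C = @sigma2 R | C = @sigma3 R] -> cone_dim C = 3%N.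
Proof.
case=> ->; rewrite ?sigma1E ?sigma2E ?sigma3E; apply: cone3_dim.
- exact: (@catl_free _ _ [:: equator2] [:: _; _; _] free12).
- exact: (@catl_free _ _ [:: equator3] [:: _; _; _] free23).
- have := free13; rewrite (@perm_free _ _ _ [:: pole1; pole2; equator3; equator1]).
    exact: (@catl_free _ _ [:: equator1] [:: _; _; _]).
  by rewrite !perm_cons (perm_catC [:: equator1] [:: equator3]).
Qed.

End Fan.

Theorem mainTheorem2 (R : realType) :
  [/\ @entropy_image R 3 `<=` @supermodular_cone R 3,
      @entropy_image R 3 =
        minkowski_sum (@entropy_proj R) [set` lineality3 R]
    & @entropy_proj R = @sigma1 R `|` @sigma2 R `|` @sigma3 R]
  /\
  [/\ [/\ polyhedral_fan (@entropy_fan R),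
          fan_support (@entropy_fan R) = @entropy_proj R
        & fan_dim_is (@entropy_fan R) 3%N],
      forall C : set (setvec R 3),
        [\/ C = @sigma1 R, C = @sigma2 R | C = @sigma3 R] ->
        [/\ polyhedral_cone C, pointed C & cone_dim C = 3%N],
      @entropy_proj R `<=` @supermodular_proj R
    & [/\ polyhedral_cone (@supermodular_proj R),
          pointed (@supermodular_proj R)
        & cone_dim (@supermodular_proj R) = 4%N]].
Proof.
have projE : @entropy_proj R = @sigma1 R `|` @sigma2 R `|` @sigma3 R.
  by apply/seteqP; split; [exact: entropy_proj_sub|exact: entropy_proj_sup].
have projS : @entropy_proj R `<=` @supermodular_proj R.
  exact: image_subset (@entropy_image_super R).
split; split.
- exact: entropy_image_super.
- by apply: projW_sum => u v; exact: entropy_image_lineality.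
- exact: projE.
- split; first exact: entropy_fan_polyhedral.
    rewrite projE; apply/seteqP; split=> [v [F + Fv]|v].
      by move=> [[l [_ FE]]|[l [_ FE]]|[l [_ FE]]]; move: Fv; rewrite FE => -[sv _];
        [left; left|left; right|right].
    move=> [[sv|sv]|sv]; [exists (@sigma1 R)|exists (@sigma2 R)|exists (@sigma3 R)] => //;
      [constructor 1|constructor 2|constructor 3]; exact: is_face_refl.
  split=> [F|]; last first.
    exists (@sigma1 R); split; first by constructor 1; exact: is_face_refl.
    by apply: sigma_dim; constructor 1.
  by case=> -[l [_ ->]]; apply: leq_trans (cone_dim_le (@subIsetl _ _ _)) _;
    rewrite sigma_dim //; [constructor 1|constructor 2|constructor 3].
- move=> C CE; have pC : polyhedral_cone C.
    by case: CE => ->; [exact: polyhedral_sigma1|exact: polyhedral_sigma2|exact: polyhedral_sigma3].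
  split; [exact: pC| |exact: sigma_dim].
  apply: pointed_sub (pointed_supermodular_proj R).
    apply: subset_trans projS; rewrite projE.
    by case: CE => -> v Cv; [left; left|left; right|right].
  by case: pC => s -> l _; rewrite linear0.
- exact: projS.
- split; [exact: polyhedral_supermodular_proj|exact: pointed_supermodular_proj|].
  exact: supermodular_proj_dim.
Qed.
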